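(* Varieties generated by kites form a complete sublattice of the lattice $\Lambda(\mathsf{P\Psi MV})$ of subvarieties of $\mathsf{P\Psi MV}$, with $\mathsf{P\Psi MV}$ being its largest element and the variety $\mathsf{BA}$ of Boolean algebras its smallest element.
   Context: A residuated lattice is an algebra $(A;\wedge,\vee,\cdot,\backslash,/,1)$ that is a lattice and a monoid with $y\le x\backslash z\iff xy\le z\iff x\le z/y$. An FL$_w$-algebra is a residuated lattice with an additional constant $0$ such that $1$ is the greatest and $0$ the least element. A pseudo MV-algebra is an FL$_w$-algebra satisfying $x/(y\backslash x)=x\vee y=(x/y)\backslash x$. An FL$_w$-algebra $\mathbf{A}$ is perfect if there is a homomorphism $h\colon\mathbf{A}\to\mathbf{2}$ to the two-element Boolean algebra such that $x\le y$ whenever $h(x)=0$ and $h(y)=1$. $\mathsf{P\Psi MV}$ is the variety generated by all perfect pseudo MV-algebras; $\mathsf{BA}$ is the variety of Boolean algebras viewed as FL$_w$-algebras. For an $\ell$-group $\mathbf{L}$ with unit $e$, $L^-=\{x\le e\}$, $L^+=\{x\ge e\}$; for an automorphism $\lambda$ of $\mathbf{L}$, $\mathcal{K}(\mathbf{L},\lambda)=(L^-\uplus L^+;\wedge,\vee,\odot,\backslash,/,0,1)$ is the perfect pseudo MV-algebra in which $0:=e\in L^+$, $1:=e\in L^-$, $L^+$ lies entirely below $L^-$, lattice operations within $L^-$ and within $L^+$ are those of $\mathbf{L}$, and $x\odot y$ is: $xy\in L^-$ if $x,y\in L^-$; $\lambda(x)y\vee e\in L^+$ if $x\in L^-,y\in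 L^+$; $xy\vee e\in L^+$ if $x\in L^+,y\in L^-$; $e\in L^+$ if $x,y\in L^+$ (the residuals are determined by $\odot$ and the order). A B-cycle is a pair $\mathbf{B}=(B;\beta)$ with $\beta$ a bijection on $B$. A kite is an algebra $\mathcal{K}_{\mathbf{B}}(\mathbf{L}):=\mathcal{K}(\mathbf{L}^B,\lambda)$ with $\mathbf{B}=(B;\beta)$ a B-cycle, $\mathbf{L}$ an $\ell$-group and $\lambda(x)(i)=x(\beta(i))$ for $i\in B$. A variety is generated by kites if it is generated by some nonempty class of kites. A complete sublattice is a subset closed under joins and meets of arbitrary nonempty families. *)

(* Defs.v *)
From mathcomp Require Export all_boot.
From mathcomp Require Export boolp classical_sets.

Set Implicit Arguments.
Unset Strict Implicit.
Unset Printing Implicit Defensive.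

Local Open Scope classical_set_scope.

(* The algebras live on arbitrary types, with equality in [Prop]: the
   varieties below range over all algebras, not only over those whose carrier
   comes with a [choiceType] and boolean operations. *)

Record lattice := Lattice {
  lat_sort :> Type;
  meet : lat_sort -> lat_sort -> lat_sort;
  join : lat_sort -> lat_sort -> lat_sort;
  meetC : commutative meet;
  joinC : commutative join;
  meetA : associative meet;
  joinA : associative join;
  meet_joinK : forall x y, meet x (join x y) = x;
  join_meetK : forall x y, join x (meet x y) = x }.

Definition le (L : lattice) (x y : L) : Prop := meet x y = x.

(* [ldiv x z] is x \ z and [rdiv z y] is z / y. *)
Record residuated_lattice := ResiduatedLattice {
  rl_lattice :> lattice;
  mul : rl_lattice -> rl_lattice -> rl_lattice;
  ldiv : rl_lattice -> rl_lattice -> rl_lattice;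
  rdiv : rl_lattice -> rl_lattice -> rl_lattice;
  one : rl_lattice;
  mul_assoc : associative mul;
  mul_onel : left_id one mul;
  mul_oner : right_id one mul;
  ldiv_residual : forall x y z, le y (ldiv x z) <-> le (mul x y) z;
  rdiv_residual : forall x y z, le x (rdiv z y) <-> le (mul x y) z }.

Record flw := FLw {
  flw_rl :> residuated_lattice;
  zero : flw_rl;
  le_one : forall x : flw_rl, le x (one flw_rl);
  zero_le : forall x : flw_rl, le zero x }.

Arguments one {r}.
Arguments zero {f}.

Record lgroup := LGroup {
  lg_lattice :> lattice;
  gmul : lg_lattice -> lg_lattice -> lg_lattice;
  ginv : lg_lattice -> lg_lattice;
  gone : lg_lattice;
  gmul_assoc : associative gmul;
  gmul_onel : left_id gone gmul;
  gmul_invl : left_inverse gone ginv gmul;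
  gmul_le2l : forall z x y, le x y -> le (gmul z x) (gmul z y);
  gmul_le2r : forall z x y, le x y -> le (gmul x z) (gmul y z) }.

Arguments gone {l}.

(* The inverse of a bijection is kept as data: it is needed to compute one of
   the residuals of K(L, lambda), and it is unique. *)
Record lgroup_aut (L : lgroup) := LGroupAut {
  aut :> L -> L;
  aut_inv : L -> L;
  autK : cancel aut aut_inv;
  aut_invK : cancel aut_inv aut;
  autM : {morph aut : x y / gmul x y};
  aut_meet : {morph aut : x y / meet x y};
  aut_join : {morph aut : x y / join x y} }.

Record bcycle := BCycle {
  bc_sort :> Type;
  beta : bc_sort -> bc_sort;
  beta_inv : bc_sort -> bc_sort;
  betaK : cancel beta beta_inv;
  beta_invK : cancel beta_inv beta }.

Section LatticeTheory.
Variable L : lattice.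
Implicit Types x y z : L.

Lemma meetxx x : meet x x = x.
Proof. by rewrite -{2}(join_meetK x x) meet_joinK. Qed.

Lemma joinxx x : join x x = x.
Proof. by rewrite -{2}(meet_joinK x x) join_meetK. Qed.

Lemma le_refl x : le x x. Proof. exact: meetxx. Qed.

Lemma le_trans y x z : le x y -> le y z -> le x z.
Proof. by rewrite /le => xy yz; rewrite -xy -meetA yz. Qed.

Lemma le_anti x y : le x y -> le y x -> x = y.
Proof. by rewrite /le => xy yx; rewrite -xy meetC yx. Qed.

Lemma le_joinE x y : le x y <-> join x y = y.
Proof.
split=> [<-|<-]; first by rewrite joinC meetC join_meetK.
exact: meet_joinK.
Qed.

Lemma meet_lel x y : le (meet x y) x.
Proof. by rewrite /le meetC meetA meetxx. Qed.

Lemma meet_ler x y : le (meet x y) y.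
Proof. by rewrite meetC; apply: meet_lel. Qed.

Lemma join_gel x y : le x (join x y). Proof. exact: meet_joinK. Qed.

Lemma join_ger x y : le y (join x y).
Proof. by rewrite joinC; apply: join_gel. Qed.

Lemma le_meet x y z : le z (meet x y) <-> le z x /\ le z y.
Proof.
split=> [zxy|[zx zy]].
  by split; apply: (le_trans zxy); [apply: meet_lel|apply: meet_ler].
by rewrite /le meetA zx.
Qed.

Lemma join_le x y z : le (join x y) z <-> le x z /\ le y z.
Proof.
split=> [xyz|[/le_joinE xz /le_joinE yz]].
  by split; apply: (le_trans _ xyz); [apply: join_gel|apply: join_ger].
by apply/le_joinE; rewrite -joinA yz.
Qed.

End LatticeTheory.

Section LGroupTheory.
Variable L : lgroup.
Implicit Types x y z : L.

Lemma gmulI x y : gmul (ginv x) (gmul x y) = y.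
Proof. by rewrite gmul_assoc gmul_invl gmul_onel. Qed.

Lemma gmul_invr x : gmul x (ginv x) = gone.
Proof.
have e : gmul (gmul x (ginv x)) (gmul x (ginv x)) = gmul x (ginv x).
  by rewrite -gmul_assoc gmulI.
by rewrite -(gmulI (gmul x (ginv x)) (gmul x (ginv x))) e gmul_invl.
Qed.

Lemma gmul_oner x : gmul x gone = x.
Proof. by rewrite -(gmul_invl x) gmul_assoc gmul_invr gmul_onel. Qed.

Lemma gmulK x y : gmul (gmul y x) (ginv x) = y.
Proof. by rewrite -gmul_assoc gmul_invr gmul_oner. Qed.

Lemma gmulKV x y : gmul x (gmul (ginv x) y) = y.
Proof. by rewrite gmul_assoc gmul_invr gmul_onel. Qed.

Lemma gmulVK x y : gmul (gmul y (ginv x)) x = y.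
Proof. by rewrite -gmul_assoc gmul_invl gmul_oner. Qed.

Lemma gmul_leL x y z : le (gmul x y) z <-> le y (gmul (ginv x) z).
Proof.
split=> [/(gmul_le2l (ginv x))|/(gmul_le2l x)]; first by rewrite gmulI.
by rewrite gmulKV.
Qed.

Lemma gmul_leR x y z : le (gmul x y) z <-> le x (gmul z (ginv y)).
Proof.
split=> [/(gmul_le2r (ginv y))|/(gmul_le2r y)]; first by rewrite gmulK.
by rewrite gmulVK.
Qed.

Lemma gmul_le1 x y : le x gone -> le y gone -> le (gmul x y) gone.
Proof.
by move=> x1 /(gmul_le2l x); rewrite gmul_oner => /le_trans; apply.
Qed.

Lemma gmul_join x y z : gmul x (join y z) = join (gmul x y) (gmul x z).
Proof.
apply: le_anti; last first.
  by apply/join_le; split; apply: gmul_le2l; [apply: join_gel|apply: join_ger].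
by apply/gmul_leL/join_le; split; apply/gmul_leL; [apply: join_gel|apply: join_ger].
Qed.

Lemma join_gmul x y z : gmul (join y z) x = join (gmul y x) (gmul z x).
Proof.
apply: le_anti; last first.
  by apply/join_le; split; apply: gmul_le2r; [apply: join_gel|apply: join_ger].
by apply/gmul_leR/join_le; split; apply/gmul_leR; [apply: join_gel|apply: join_ger].
Qed.

Lemma div_leL x z : le x gone -> le gone z -> le gone (gmul (ginv x) z).
Proof. by move=> x1 z1; apply/gmul_leL; rewrite gmul_oner; apply: le_trans z1. Qed.

Lemma div_leR y z : le y gone -> le gone z -> le gone (gmul z (ginv y)).
Proof. by move=> y1 z1; apply/gmul_leR; rewrite gmul_onel; apply: le_trans z1. Qed.

Variable f : lgroup_aut L.

Lemma aut1 : f gone = gone.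
Proof. by rewrite -(gmulI (f gone) (f gone)) -autM gmul_onel gmul_invl. Qed.

Lemma aut_le x y : le x y <-> le (f x) (f y).
Proof.
split; rewrite /le -aut_meet; first by move->.
by move/(can_inj (autK f)).
Qed.

Lemma aut_le1 x : le x gone -> le (f x) gone.
Proof. by move/aut_le; rewrite aut1. Qed.

End LGroupTheory.

Section Cones.
Variables (L : lgroup) (lam : lgroup_aut L).

Definition neg_cone := {x : L | le x gone}.
Definition pos_cone := {x : L | le gone x}.

(* [inl x] is x in L^-, and [inr x] is x in L^+. *)
Definition cone_sort : Type := (neg_cone + pos_cone)%type.

Lemma inl_eq (a b : neg_cone) : sval a = sval b -> inl a = inl b :> cone_sort.
Proof.
case: a b => [a pa] [b pb] /= e; rewrite -{}e in pb *.
by rewrite (Prop_irrelevance pa pb).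
Qed.

Lemma inr_eq (a b : pos_cone) : sval a = sval b -> inr a = inr b :> cone_sort.
Proof.
case: a b => [a pa] [b pb] /= e; rewrite -{}e in pb *.
by rewrite (Prop_irrelevance pa pb).
Qed.

Definition in_neg (x : L) (x1 : le x gone) : cone_sort := inl (exist _ x x1).
Definition in_pos (x : L) (x1 : le gone x) : cone_sort := inr (exist _ x x1).

Definition meet_neg (x : L) : cone_sort := in_neg (meet_ler x gone).
Definition join_pos (x : L) : cone_sort := in_pos (join_ger x gone).

Definition cone_zero : cone_sort := in_pos (le_refl (@gone L)).
Definition cone_one : cone_sort := in_neg (le_refl (@gone L)).

Lemma neg_meet (x y : neg_cone) : le (meet (sval x) (sval y)) gone.
Proof. by apply: (le_trans (meet_lel _ _)); case: x. Qed.
Lemma neg_join (x y : neg_cone) : le (join (sval x) (sval y)) gone.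
Proof. by apply/join_le; case: x; case: y. Qed.
Lemma pos_meet (x y : pos_cone) : le gone (meet (sval x) (sval y)).
Proof. by apply/le_meet; case: x; case: y. Qed.
Lemma pos_join (x y : pos_cone) : le gone (join (sval x) (sval y)).
Proof. by apply: (le_trans _ (join_gel _ _)); case: x. Qed.
Lemma neg_gmul (x y : neg_cone) : le (gmul (sval x) (sval y)) gone.
Proof. by apply: gmul_le1; [case: x|case: y]. Qed.
Lemma pos_ldiv (x : neg_cone) (z : pos_cone) :
  le gone (gmul (ginv (lam (sval x))) (sval z)).
Proof. by apply: div_leL; [apply: aut_le1; case: x|case: z]. Qed.
Lemma pos_rdiv (z : pos_cone) (y : neg_cone) :
  le gone (gmul (sval z) (ginv (sval y))).
Proof. by apply: div_leR; [case: y|case: z]. Qed.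

Definition cone_meet (a b : cone_sort) : cone_sort :=
  match a, b with
  | inl x, inl y => in_neg (neg_meet x y)
  | inl _, inr y => inr y
  | inr x, inl _ => inr x
  | inr x, inr y => in_pos (pos_meet x y)
  end.

Definition cone_join (a b : cone_sort) : cone_sort :=
  match a, b with
  | inl x, inl y => in_neg (neg_join x y)
  | inl x, inr _ => inl x
  | inr _, inl y => inl y
  | inr x, inr y => in_pos (pos_join x y)
  end.

Definition cone_mul (a b : cone_sort) : cone_sort :=
  match a, b with
  | inl x, inl y => in_neg (neg_gmul x y)
  | inl x, inr y => join_pos (gmul (lam (sval x)) (sval y))
  | inr x, inl y => join_pos (gmul (sval x) (sval y))
  | inr _, inr _ => cone_zero
  end.

(* The residuals are forced by [cone_mul] and the order; these are the explicit
   formulas, where [cone_ldiv a c] is a \ c and [cone_rdiv c b] is c / b. *)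
Definition cone_ldiv (a c : cone_sort) : cone_sort :=
  match a, c with
  | inl x, inl z => meet_neg (gmul (ginv (sval x)) (sval z))
  | inl x, inr z => in_pos (pos_ldiv x z)
  | inr _, inl _ => cone_one
  | inr x, inr z => meet_neg (gmul (ginv (sval x)) (sval z))
  end.

Definition cone_rdiv (c b : cone_sort) : cone_sort :=
  match b, c with
  | inl y, inl z => meet_neg (gmul (sval z) (ginv (sval y)))
  | inl y, inr z => in_pos (pos_rdiv z y)
  | inr _, inl _ => cone_one
  | inr y, inr z => meet_neg (aut_inv lam (gmul (sval z) (ginv (sval y))))
  end.

Ltac cone_eq :=
  rewrite //=; first [ apply: inl_eq | apply: inr_eq | idtac ]; rewrite //=.

Lemma cone_meetC : commutative cone_meet.
Proof. by move=> [x|x] [y|y]; cone_eq; rewrite meetC. Qed.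
Lemma cone_joinC : commutative cone_join.
Proof. by move=> [x|x] [y|y]; cone_eq; rewrite joinC. Qed.
Lemma cone_meetA : associative cone_meet.
Proof. by move=> [x|x] [y|y] [z|z]; cone_eq; rewrite meetA. Qed.
Lemma cone_joinA : associative cone_join.
Proof. by move=> [x|x] [y|y] [z|z]; cone_eq; rewrite joinA. Qed.
Lemma cone_meet_joinK a b : cone_meet a (cone_join a b) = a.
Proof. by case: a b => [x|x] [y|y]; cone_eq; rewrite (meet_joinK, meetxx). Qed.
Lemma cone_join_meetK a b : cone_join a (cone_meet a b) = a.
Proof. by case: a b => [x|x] [y|y]; cone_eq; rewrite (join_meetK, joinxx). Qed.

Definition cone_lattice : lattice :=
  Lattice cone_meetC cone_joinC cone_meetA cone_joinA
    cone_meet_joinK cone_join_meetK.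

Lemma cone_leE (a b : cone_lattice) :
  le a b <-> match a, b with
             | inl x, inl y => le (sval x) (sval y)
             | inr x, inr y => le (sval x) (sval y)
             | inr _, inl _ => True
             | inl _, inr _ => False
             end.
Proof.
rewrite /le; case: a b => [x|x] [y|y] //=; split=> //.
- by case=> {2}<-.
- by move=> e; apply: inl_eq.
- by case=> {2}<-.
- by move=> e; apply: inr_eq.
Qed.

Lemma cone_mulA : associative cone_mul.
Proof.
have j1 (t u : L) : le u gone ->
    join (gmul u (join t gone)) gone = join (gmul u t) gone.
  by move=> u1; rewrite gmul_join gmul_oner -joinA; move/le_joinE: u1 => ->.
have j2 (t u : L) : le u gone ->
    join (gmul (join t gone) u) gone = join (gmul t u) gone.
  by move=> u1; rewrite join_gmul gmul_onel -joinA; move/le_joinE: u1 => ->.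
move=> [[x px]|[x px]] [[y py]|[y py]] [[z pz]|[z pz]]; cone_eq.
- by rewrite gmul_assoc.
- by rewrite j1 ?autM ?gmul_assoc //; apply: aut_le1.
- by rewrite j1 ?j2 ?gmul_assoc //; apply: aut_le1.
- by rewrite gmul_oner; apply/le_joinE/aut_le1.
- by rewrite j2 ?gmul_assoc.
- by rewrite gmul_onel; apply/esym/le_joinE.
Qed.

Lemma cone_mul1 : left_id cone_one cone_mul.
Proof.
move=> [[x px]|[x px]]; cone_eq; rewrite ?aut1 gmul_onel //.
by rewrite joinC; apply/le_joinE.
Qed.

Lemma cone_mulr1 : right_id cone_one cone_mul.
Proof.
move=> [[x px]|[x px]]; cone_eq; rewrite gmul_oner //.
by rewrite joinC; apply/le_joinE.
Qed.

Lemma cone_le_one (a : cone_lattice) : le a cone_one.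
Proof. by apply/cone_leE; case: a => [[]|]. Qed.

Lemma cone_zero_le (a : cone_lattice) : le (cone_zero : cone_lattice) a.
Proof. by apply/cone_leE; case: a => [|[]]. Qed.

Lemma cone_ldivP (a b c : cone_lattice) :
  le b (cone_ldiv a c) <-> le (cone_mul a b : cone_lattice) c.
Proof.
have mE (t u : L) : le u gone -> (le u (meet t gone) <-> le u t).
  by move=> u1; split=> [/le_meet[]//|ut]; apply/le_meet.
have jE (t u : L) : le gone u -> (le (join t gone) u <-> le t u).
  by move=> u1; split=> [/join_le[]//|ut]; apply/join_le.
split=> [/cone_leE h|/cone_leE h]; apply/cone_leE;
  case: a b c h => [[x px]|[x px]] [[y py]|[y py]] [[z pz]|[z pz]] //=.
- by move/mE => /(_ py) /gmul_leL.
- by move=> h; apply/jE/gmul_leL.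
- by move/mE => /(_ py) h; apply/jE/gmul_leL.
- by move=> h; apply/mE/gmul_leL.
- by move/jE => /(_ pz) /gmul_leL.
- by move/jE => /(_ pz) h; apply/mE/gmul_leL.
Qed.

Lemma cone_rdivP (a b c : cone_lattice) :
  le a (cone_rdiv c b) <-> le (cone_mul a b : cone_lattice) c.
Proof.
have mE (t u : L) : le u gone -> (le u (meet t gone) <-> le u t).
  by move=> u1; split=> [/le_meet[]//|ut]; apply/le_meet.
have jE (t u : L) : le gone u -> (le (join t gone) u <-> le t u).
  by move=> u1; split=> [/join_le[]//|ut]; apply/join_le.
have iE (t u : L) : le t (aut_inv lam u) <-> le (lam t) u.
  by rewrite -{2}(aut_invK lam u) -aut_le.
split=> [/cone_leE h|/cone_leE h]; apply/cone_leE;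
  case: a b c h => [[x px]|[x px]] [[y py]|[y py]] [[z pz]|[z pz]] //=.
- by move/mE => /(_ px) /gmul_leR.
- by move/mE => /(_ px) /iE h; apply/jE/gmul_leR.
- by move=> h; apply/jE/gmul_leR.
- by move=> h; apply/mE/gmul_leR.
- by move/jE => /(_ pz) h; apply/mE/iE/gmul_leR.
- by move/jE => /(_ pz) /gmul_leR.
Qed.

Definition cone_rl : residuated_lattice :=
  @ResiduatedLattice cone_lattice cone_mul cone_ldiv cone_rdiv cone_one
    cone_mulA cone_mul1 cone_mulr1 cone_ldivP cone_rdivP.

(* K(L, lambda) *)
Definition cone_flw : flw := @FLw cone_rl cone_zero cone_le_one cone_zero_le.

End Cones.

Section Power.
Variables (L : lgroup) (B : bcycle).
Implicit Types x y z : B -> L.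

Definition pow_meet x y : B -> L := fun i => meet (x i) (y i).
Definition pow_join x y : B -> L := fun i => join (x i) (y i).
Definition pow_mul x y : B -> L := fun i => gmul (x i) (y i).
Definition pow_inv x : B -> L := fun i => ginv (x i).
Definition pow_one : B -> L := fun=> gone.

Lemma pow_meetC : commutative pow_meet.
Proof. by move=> x y; apply/funext => i; apply: meetC. Qed.
Lemma pow_joinC : commutative pow_join.
Proof. by move=> x y; apply/funext => i; apply: joinC. Qed.
Lemma pow_meetA : associative pow_meet.
Proof. by move=> x y z; apply/funext => i; apply: meetA. Qed.
Lemma pow_joinA : associative pow_join.
Proof. by move=> x y z; apply/funext => i; apply: joinA. Qed.
Lemma pow_meet_joinK x y : pow_meet x (pow_join x y) = x.
Proof. by apply/funext => i; apply: meet_joinK. Qed.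
Lemma pow_join_meetK x y : pow_join x (pow_meet x y) = x.
Proof. by apply/funext => i; apply: join_meetK. Qed.

Definition pow_lattice : lattice :=
  Lattice pow_meetC pow_joinC pow_meetA pow_joinA pow_meet_joinK pow_join_meetK.

Lemma pow_leE (x y : pow_lattice) : le x y <-> forall i, le (x i) (y i).
Proof.
split=> [h i|h]; last by apply/funext => i; apply: h.
by move/(congr1 (fun f : B -> L => f i)): h.
Qed.

Lemma pow_mulA : associative pow_mul.
Proof. by move=> x y z; apply/funext => i; apply: gmul_assoc. Qed.
Lemma pow_mul1 : left_id pow_one pow_mul.
Proof. by move=> x; apply/funext => i; apply: gmul_onel. Qed.
Lemma pow_mulV : left_inverse pow_one pow_inv pow_mul.
Proof. by move=> x; apply/funext => i; apply: gmul_invl. Qed.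
Lemma pow_le2l (z x y : pow_lattice) :
  le x y -> le (pow_mul z x : pow_lattice) (pow_mul z y).
Proof. by move/pow_leE => h; apply/pow_leE => i; apply: gmul_le2l. Qed.
Lemma pow_le2r (z x y : pow_lattice) :
  le x y -> le (pow_mul x z : pow_lattice) (pow_mul y z).
Proof. by move/pow_leE => h; apply/pow_leE => i; apply: gmul_le2r. Qed.

Definition pow_lgroup : lgroup :=
  @LGroup pow_lattice pow_mul pow_inv pow_one
    pow_mulA pow_mul1 pow_mulV pow_le2l pow_le2r.

Definition shift (x : pow_lgroup) : pow_lgroup := fun i => x (beta i).
Definition shift_inv (x : pow_lgroup) : pow_lgroup := fun i => x (beta_inv i).

Lemma shiftK : cancel shift shift_inv.
Proof. by move=> x; apply/funext => i; rewrite /shift_inv /shift beta_invK. Qed.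
Lemma shift_invK : cancel shift_inv shift.
Proof. by move=> x; apply/funext => i; rewrite /shift_inv /shift betaK. Qed.

Definition shift_aut : lgroup_aut pow_lgroup :=
  @LGroupAut pow_lgroup shift shift_inv shiftK shift_invK
    (fun _ _ => erefl) (fun _ _ => erefl) (fun _ _ => erefl).

(* K_B(L) = K(L^B, lambda) with lambda(x)(i) = x(beta(i)) *)
Definition kite : flw := cone_flw shift_aut.

End Power.

Inductive term : Type :=
  | Var of nat
  | Zero
  | One
  | Meet of term & term
  | Join of term & term
  | Mul of term & term
  | Ldiv of term & term
  | Rdiv of term & term.

Fixpoint eval (A : flw) (v : nat -> A) (t : term) : A :=
  match t with
  | Var n => v n
  | Zero => zero
  | One => one
  | Meet s t => meet (eval v s) (eval v t)
  | Join s t => join (eval v s) (eval v t)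
  | Mul s t => mul (eval v s) (eval v t)
  | Ldiv s t => ldiv (eval v s) (eval v t)
  | Rdiv s t => rdiv (eval v s) (eval v t)
  end.

Definition satisfies (A : flw) (e : term * term) : Prop :=
  forall v : nat -> A, eval v e.1 = eval v e.2.

Definition models (E : set (term * term)) : set flw :=
  [set A | forall e, E e -> satisfies A e].

Definition variety (V : set flw) : Prop := exists E, V = models E.

(* the least variety containing K *)
Definition generated (K : set flw) : set flw := smallest variety K.

Definition subvarieties (W : set flw) : set (set flw) :=
  [set V | variety V /\ V `<=` W].

(* Meet and join of a nonempty family in the lattice of subvarieties of a
   variety; see [variety_meetP] and [variety_joinP]. *)
Definition variety_meet (F : set (set flw)) : set flw := \bigcap_(V in F) V.
Definition variety_join (F : set (set flw)) : set flw :=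
  generated (\bigcup_(V in F) V).

Lemma variety_bigcap (F : set (set flw)) :
  F `<=` variety -> variety (\bigcap_(V in F) V).
Proof.
move=> Fv; exists [set e | exists E, F (models E) /\ E e].
apply/seteqP; split=> [A FA e [E [FE Ee]]|A AE V FV].
  exact: (FA _ FE).
have [E VE] := Fv _ FV; rewrite VE => e Ee; apply: AE.
by exists E; rewrite -VE.
Qed.

Lemma generated_variety K : variety (generated K).
Proof. by apply: variety_bigcap => V []. Qed.

Lemma variety_meetP W F : F !=set0 -> F `<=` subvarieties W ->
  [/\ subvarieties W (variety_meet F),
      forall V, F V -> variety_meet F `<=` V &
      forall U, subvarieties W U -> (forall V, F V -> U `<=` V) ->
        U `<=` variety_meet F].
Proof.
move=> [V FV] FW; split=> [|U FU|U _ UF].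
- split; first by apply: variety_bigcap => U /FW[].
  by move=> A /(_ _ FV); case: (FW _ FV) => _; apply.
- by move=> A; apply.
- by move=> A UA X /UF; apply.
Qed.

Lemma variety_joinP W F : variety W -> F `<=` subvarieties W ->
  [/\ subvarieties W (variety_join F),
      forall V, F V -> V `<=` variety_join F &
      forall U, subvarieties W U -> (forall V, F V -> V `<=` U) ->
        variety_join F `<=` U].
Proof.
move=> Wv FW; split=> [|V FV|U [Uv _] UF].
- split; first exact: generated_variety.
  by apply: smallest_sub => // A [V /FW[_ VW] /VW].
- by move=> A VA; apply: sub_gen_smallest; exists V.
- by apply: smallest_sub => // A [V /UF VU /VU].
Qed.

(* S is a complete sublattice of the lattice of subvarieties of W. *)
Definition complete_sublattice (W : set flw) (S : set (set flw)) : Prop :=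
  S `<=` subvarieties W /\
  forall F, F !=set0 -> F `<=` S -> S (variety_meet F) /\ S (variety_join F).

Definition pseudo_mv (A : flw) : Prop :=
  forall x y : A, rdiv x (ldiv y x) = join x y /\ join x y = ldiv (rdiv x y) x.

Definition homomorphism (A C : flw) (h : A -> C) : Prop :=
  [/\ {morph h : x y / meet x y}, {morph h : x y / join x y},
      {morph h : x y / mul x y}, {morph h : x y / ldiv x y} &
      [/\ {morph h : x y / rdiv x y}, h zero = zero & h one = one]].

Lemma andb_orbK (x y : bool) : x && (x || y) = x. Proof. by case: x. Qed.
Lemma orb_andbK (x y : bool) : x || x && y = x. Proof. by case: x. Qed.

Definition two_lattice : lattice :=
  Lattice andbC orbC andbA orbA andb_orbK orb_andbK.

Definition two_rl : residuated_lattice.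
Proof.
refine (@ResiduatedLattice two_lattice andb implb (fun z y => y ==> z) true
  andbA andTb andbT _ _); by rewrite /le => -[] [] [].
Defined.

Definition two : flw.
Proof. refine (@FLw two_rl false _ _); by rewrite /le => -[]. Defined.

Definition perfect (A : flw) : Prop :=
  exists h : A -> two, homomorphism h /\
    forall x y, h x = zero -> h y = one -> le x y.

Definition PPsiMV : set flw := generated [set A | pseudo_mv A /\ perfect A].

(* In an FL_w-algebra with mul = meet the residuals are forced: if x' is the
   complement of x then x \ y = y / x = x' \/ y. *)
Definition BA : set flw :=
  [set A : flw | [/\ forall x y z : A, meet x (join y z) = join (meet x y) (meet x z),
    forall x : A, exists y, meet x y = zero /\ join x y = one &
    forall x y : A, mul x y = meet x y]].

Definition kites : set flw := [set A | exists L B, A = kite L B].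

Definition generated_by_kites (V : set flw) : Prop :=
  exists K, [/\ K !=set0, K `<=` kites & V = generated K].

(* Main.v *)
Require Import Defs.
Local Open Scope classical_set_scope.

Set Implicit Arguments.
Unset Strict Implicit.
Unset Printing Implicit Defensive.

(** The join of varieties generated by classes of kites is generated by the kites in
    the union of these varieties. The proof for meets has two ingredients.

    The first describes the subdirectly irreducible algebras A in the variety generated
    by the perfect pseudo MV-algebras. In a perfect algebra the term
    ~((~(x^2))^2), with ~x = x \ 0, is zero on the lower part and one on the upper part.
    The equations that express this make its values in A induce direct decompositions, so
    that it takes only the values zero and one in A, and A is perfect
    ([monolith_perfect]). The upper part of a perfect pseudo MV-algebra is a cancellative
    monoid ordered by divisibility, thus the negative cone of its l-group of fractions L.
    With lambda = ~~ this gives an isomorphism of A with K(L, lambda)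
    ([perfect_representation]). Finally K(L, lambda) embeds into a kite, by sending x to
    the family of all f(x), for f in the B-cycle E of all endomorphisms of L that commute
    with lambda ([cone_in_kite]). In particular the kites generate the whole variety.

    The second ingredient is that, if A = K(L, lambda) is subdirectly irreducible and
    belongs to the variety generated by a class of kites, then so does the kite over E
    ([irreducible_kite]). Suppose that an equation holds in the class and fails in the
    kite over E. At one coordinate, where only the coordinates beta^k with k at most some
    M matter, the failure says that an identity of l-groups fails in L, for a tuple of
    elements in which the k-th and the k'-th entry agree when lambda^k = lambda^k'. In a
    kite of the class, this identity can fail at a coordinate c only if beta^m c = c for
    some m at most M with lambda^m not the identity ([unrollP]). Irreducibility of A allows one
    to combine the failing identity and the failing identities lambda^m(x) = x, for these
    finitely many m, into a single identity, by meets of suitable conjugates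
    ([separating_term]); it fails in L but holds in all kites of the class. This is
    impossible, because every l-group term is a fraction of two terms with values in the
    negative cone, so that identities of l-groups with an automorphism pass from the class
    to A ([transfer]).

    For the meet of a family of varieties generated by kites, an equation that fails in the
    meet fails in a subdirectly irreducible algebra A of the meet, hence in the kite over E,
    which belongs to all members of the family. For Boolean algebras, every kite
    contains the two-element algebra, and a subdirectly irreducible Boolean algebra has two
    elements. *)

(** * FL_w-algebras, homomorphisms and varieties *)

Section Residuation.
Variable A : flw.
Implicit Types x y z : A.

Lemma mul_ldiv_le x z : le (mul x (ldiv x z)) z.
Proof. by apply/ldiv_residual/le_refl. Qed.

Lemma rdiv_mul_le z y : le (mul (rdiv z y) y) z.
Proof. by apply/rdiv_residual/le_refl. Qed.

Lemma mul_le2l z x y : le x y -> le (mul z x) (mul z y).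
Proof. by move=> xy; apply/ldiv_residual/(le_trans xy)/ldiv_residual/le_refl. Qed.

Lemma mul_le2r z x y : le x y -> le (mul x z) (mul y z).
Proof. by move=> xy; apply/rdiv_residual/(le_trans xy)/rdiv_residual/le_refl. Qed.

Lemma meet_one x : meet x one = x. Proof. exact: le_one. Qed.

Lemma meet_zero x : meet x zero = zero.
Proof. by rewrite meetC; apply: zero_le. Qed.

Lemma join_zero x : join x zero = x.
Proof. by rewrite joinC; apply/le_joinE/zero_le. Qed.

Lemma join_one x : join x one = one. Proof. by apply/le_joinE/le_one. Qed.

Lemma mul_zero x : mul x zero = zero.
Proof. by apply: le_anti (zero_le _); apply/ldiv_residual/zero_le. Qed.

Lemma zero_mul x : mul zero x = zero.
Proof. by apply: le_anti (zero_le _); apply/rdiv_residual/zero_le. Qed.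

Lemma ldiv_eq1 x y : ldiv x y = one <-> le x y.
Proof.
split=> [e|xy]; first by rewrite -(mul_oner x); apply/ldiv_residual; rewrite e; apply: le_refl.
by apply: le_anti (le_one _) _; apply/ldiv_residual; rewrite mul_oner.
Qed.

Lemma rdiv_eq1 x y : rdiv y x = one <-> le x y.
Proof.
split=> [e|xy]; first by rewrite -(mul_onel x); apply/rdiv_residual; rewrite e; apply: le_refl.
by apply: le_anti (le_one _) _; apply/rdiv_residual; rewrite mul_onel.
Qed.

Lemma ldiv_one x : ldiv one x = x.
Proof.
apply: le_anti; last by apply/ldiv_residual; rewrite mul_onel; apply: le_refl.
by rewrite -{1}(mul_onel (ldiv one x)); apply: mul_ldiv_le.
Qed.

Lemma rdiv_one x : rdiv x one = x.
Proof.
apply: le_anti; last by apply/rdiv_residual; rewrite mul_oner; apply: le_refl.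
by rewrite -{1}(mul_oner (rdiv x one)); apply: rdiv_mul_le.
Qed.

End Residuation.

Lemma le_ext (L : lattice) (x y : L) : (forall z, le z x <-> le z y) -> x = y.
Proof. by move=> h; apply: le_anti; [apply/h|apply/h]; apply: le_refl. Qed.

Lemma hom_eval (A C : flw) (h : A -> C) (v : nat -> A) t :
  homomorphism h -> h (eval v t) = eval (h \o v) t.
Proof.
move=> [hm hj hM hl [hr h0 h1]].
by elim: t => //= s IHs t IHt; rewrite ?(hm, hj, hM, hl, hr) IHs IHt.
Qed.

(** A multiplicative order isomorphism preserves all operations, because each of
    them is determined by multiplication and the order. *)
Lemma order_iso_hom (A C : flw) (h : A -> C) :
    (forall c, exists x, h x = c) -> (forall x y, le x y <-> le (h x) (h y)) ->
    {morph h : x y / mul x y} -> homomorphism h.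
Proof.
move=> hs hle hM.
have ext x c : (forall z, le z x <-> le (h z) c) -> h x = c.
  by move=> e; apply: le_ext => d; have [z <-] := hs d; rewrite -hle e.
have hm : {morph h : x y / meet x y}.
  by move=> x y; apply: ext => z; rewrite !le_meet !hle.
split=> //; last split.
- move=> x y; apply: le_anti.
    have [z zE] := hs (join (h x) (h y)); rewrite -zE -hle.
    by apply/join_le; split; rewrite hle zE; [apply: join_gel|apply: join_ger].
  by apply/join_le; split; rewrite -hle; [apply: join_gel|apply: join_ger].
- by move=> x y; apply: ext => z; rewrite !ldiv_residual hle hM.
- by move=> x y; apply: ext => z; rewrite !rdiv_residual hle hM.
- by apply: le_anti _ (zero_le _); have [z <-] := hs zero; rewrite -hle; apply: zero_le.
- by apply: le_anti (le_one _) _; have [z <-] := hs one; rewrite -hle; apply: le_one.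
Qed.

Lemma satisfies_sub (A C : flw) (h : A -> C) e :
  homomorphism h -> injective h -> satisfies C e -> satisfies A e.
Proof. by move=> hh hi Ce v; apply: hi; rewrite !hom_eval //; apply: Ce. Qed.

Lemma satisfies_quotient (A C : flw) (h : A -> C) e :
  homomorphism h -> (forall c, exists x, h x = c) -> satisfies A e -> satisfies C e.
Proof.
move=> hh hs Ae v; have [w wE] := choice (fun n => hs (v n)).
by have -> : v = h \o w by [apply/funext => n /=]; rewrite -!hom_eval // Ae.
Qed.

Lemma variety_sub (V : set flw) (A C : flw) (h : A -> C) :
  variety V -> homomorphism h -> injective h -> V C -> V A.
Proof. by move=> [E ->] hh hi VC e /VC; apply: satisfies_sub hh hi. Qed.

Lemma variety_quotient (V : set flw) (A C : flw) (h : A -> C) :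
  variety V -> homomorphism h -> (forall c, exists x, h x = c) -> V A -> V C.
Proof. by move=> [E ->] hh hs VA e /VA; apply: satisfies_quotient hh hs. Qed.

Lemma generated_sub (K V : set flw) : variety V -> K `<=` V -> generated K `<=` V.
Proof. exact: smallest_sub. Qed.

Lemma generatedP (K : set flw) (A : flw) :
  generated K A <-> forall e, (forall C, K C -> satisfies C e) -> satisfies A e.
Proof.
split=> [KA e Ke|Ae V [[E ->] KE] e Ee]; last by apply: Ae => C /KE; apply.
have /generated_sub : variety (models [set e]) by exists [set e].
by move/(_ K); apply=> // C KC _ ->; apply: Ke.
Qed.

(** * Subdirectly irreducible quotients *)

Record congruence (A : flw) (r : A -> A -> Prop) : Prop := Congruence {
  cong_refl : forall x, r x x;
  cong_sym : forall x y, r x y -> r y x;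
  cong_trans : forall x y z, r x y -> r y z -> r x z;
  cong_meet : forall x x' y y', r x x' -> r y y' -> r (meet x y) (meet x' y');
  cong_join : forall x x' y y', r x x' -> r y y' -> r (join x y) (join x' y');
  cong_mul : forall x x' y y', r x x' -> r y y' -> r (mul x y) (mul x' y');
  cong_ldiv : forall x x' y y', r x x' -> r y y' -> r (ldiv x y) (ldiv x' y');
  cong_rdiv : forall x x' y y', r x x' -> r y y' -> r (rdiv x y) (rdiv x' y') }.

Section Quotient.
Variables (A : flw) (r : A -> A -> Prop) (rc : congruence r).

Definition quot := {S : A -> Prop | exists x, S = r x}.

Definition cls (x : A) : quot := exist _ (r x) (ex_intro _ x erefl).

Definition repr (q : quot) : A := sval (cid (proj2_sig q)).

Lemma reprK q : cls (repr q) = q.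
Proof.
rewrite /repr; case: cid => x; case: q => S SP /= e.
exact/eq_exist/esym.
Qed.

Lemma clsE x y : cls x = cls y <-> r x y.
Proof.
split=> [/(congr1 sval) /= ->|rxy]; first exact: cong_refl rc _.
apply: eq_exist => /=; apply/funext => z; apply/propext.
by split; apply: (cong_trans rc) => //; apply: cong_sym.
Qed.

Lemma cls_surj q : exists x, cls x = q. Proof. by exists (repr q); apply: reprK. Qed.

Definition qop (f : A -> A -> A) (p q : quot) : quot := cls (f (repr p) (repr q)).

Lemma qopE f x y :
    (forall x x' y y', r x x' -> r y y' -> r (f x y) (f x' y')) ->
  qop f (cls x) (cls y) = cls (f x y).
Proof. by move=> fr; apply/clsE/fr; apply/clsE; rewrite reprK. Qed.

Let qm x y : qop (@meet A) (cls x) (cls y) = cls (meet x y).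
Proof. by apply: qopE; apply: cong_meet. Qed.
Let qj x y : qop (@join A) (cls x) (cls y) = cls (join x y).
Proof. by apply: qopE; apply: cong_join. Qed.
Let qM x y : qop (@mul A) (cls x) (cls y) = cls (mul x y).
Proof. by apply: qopE; apply: cong_mul. Qed.
Let ql x y : qop (@ldiv A) (cls x) (cls y) = cls (ldiv x y).
Proof. by apply: qopE; apply: cong_ldiv. Qed.
Let qr x y : qop (@rdiv A) (cls x) (cls y) = cls (rdiv x y).
Proof. by apply: qopE; apply: cong_rdiv. Qed.

Ltac lift q := let x := fresh "x" in have [x <-] := cls_surj q.

Lemma quot_meetC : commutative (qop (@meet A)).
Proof. by move=> p q; lift p; lift q; rewrite !qm meetC. Qed.
Lemma quot_joinC : commutative (qop (@join A)).
Proof. by move=> p q; lift p; lift q; rewrite !qj joinC. Qed.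
Lemma quot_meetA : associative (qop (@meet A)).
Proof. by move=> p q s; lift p; lift q; lift s; rewrite !qm meetA. Qed.
Lemma quot_joinA : associative (qop (@join A)).
Proof. by move=> p q s; lift p; lift q; lift s; rewrite !qj joinA. Qed.
Lemma quot_meet_joinK p q : qop (@meet A) p (qop (@join A) p q) = p.
Proof. by lift p; lift q; rewrite qj qm meet_joinK. Qed.
Lemma quot_join_meetK p q : qop (@join A) p (qop (@meet A) p q) = p.
Proof. by lift p; lift q; rewrite qm qj join_meetK. Qed.

Definition quot_lattice : lattice :=
  Lattice quot_meetC quot_joinC quot_meetA quot_joinA quot_meet_joinK quot_join_meetK.

Lemma quot_mulA : associative (qop (@mul A)).
Proof. by move=> p q s; lift p; lift q; lift s; rewrite !qM mul_assoc. Qed.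
Lemma quot_mul1 : left_id (cls one) (qop (@mul A)).
Proof. by move=> p; lift p; rewrite qM mul_onel. Qed.
Lemma quot_mulr1 : right_id (cls one) (qop (@mul A)).
Proof. by move=> p; lift p; rewrite qM mul_oner. Qed.

Lemma quot_leE x y : le (cls x : quot_lattice) (cls y) <-> r (meet x y) x.
Proof. by rewrite /le /= qm clsE. Qed.

Lemma quot_le x y : le x y -> le (cls x : quot_lattice) (cls y).
Proof. by move=> xy; apply/quot_leE; rewrite xy; apply: cong_refl. Qed.

(** Residuation is not an equation, so it needs an argument: if y and the meet of y
    and g z are congruent, then so are their images under f, and the second of these
    is below f (g z), hence below z. *)
Lemma quot_residual (f g : A -> A) y z :
    (forall x x', r x x' -> r (f x) (f x')) -> (forall x x', r x x' -> r (g x) (g x')) ->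
    (forall x x', le x (g x') <-> le (f x) x') ->
  le (cls y : quot_lattice) (cls (g z)) <-> le (cls (f y) : quot_lattice) (cls z).
Proof.
move=> fr gr fg.
have fg1 x : le (f (g x)) x by apply/fg/le_refl.
have gf1 x : le x (g (f x)) by apply/fg/le_refl.
split=> /quot_leE h.
- have /fr /clsE <- := h.
  by apply: quot_le; apply/fg/meet_ler.
- apply: (@le_trans quot_lattice (cls (g (f y)))); first exact: quot_le.
  have /gr /clsE <- := h.
  by apply: quot_le; apply/fg/(le_trans (fg1 _))/meet_ler.
Qed.

Lemma quot_ldivP (p q s : quot_lattice) :
  le q (qop (@ldiv A) p s) <-> le (qop (@mul A) p q : quot_lattice) s.
Proof.
lift p; lift q; lift s; rewrite ql qM.
apply: (quot_residual (f := mul x) (g := ldiv x)) => [a b|a b|a b].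
- by apply: cong_mul => //; apply: cong_refl.
- by apply: cong_ldiv => //; apply: cong_refl.
- exact: ldiv_residual.
Qed.

Lemma quot_rdivP (p q s : quot_lattice) :
  le p (qop (@rdiv A) s q) <-> le (qop (@mul A) p q : quot_lattice) s.
Proof.
lift p; lift q; lift s; rewrite qr qM.
apply: (quot_residual (f := (@mul A)^~ x0) (g := (@rdiv A)^~ x0)) => [a b ab|a b ab|a b].
- by apply: cong_mul => //; apply: cong_refl.
- by apply: cong_rdiv => //; apply: cong_refl.
- exact: rdiv_residual.
Qed.

Definition quot_rl : residuated_lattice :=
  @ResiduatedLattice quot_lattice _ _ _ (cls one)
    quot_mulA quot_mul1 quot_mulr1 quot_ldivP quot_rdivP.

Lemma quot_le_one (q : quot_rl) : le q (one : quot_rl).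
Proof. by lift q; apply/quot_le/le_one. Qed.
Lemma quot_zero_le (q : quot_rl) : le (cls zero : quot_rl) q.
Proof. by lift q; apply/quot_le/zero_le. Qed.

Definition quot_flw : flw := @FLw quot_rl (cls zero) quot_le_one quot_zero_le.

Lemma cls_hom : @homomorphism A quot_flw cls.
Proof. by split; last split; do ?[move=> x y /=]; rewrite /= ?(qm, qj, qM, ql, qr). Qed.

End Quotient.

Lemma congruence_preim (A C : flw) (h : A -> C) (r : C -> C -> Prop) :
  homomorphism h -> congruence r -> congruence (fun x y => r (h x) (h y)).
Proof.
move=> [hm hj hM hl [hr _ _]] rc.
split=> [x|x y|x y z|x x' y y'|x x' y y'|x x' y y'|x x' y y'|x x' y y'];
  rewrite ?(hm, hj, hM, hl, hr).
- exact: cong_refl.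
- exact: cong_sym.
- exact: cong_trans.
- exact: cong_meet.
- exact: cong_join.
- exact: cong_mul.
- exact: cong_ldiv.
- exact: cong_rdiv.
Qed.

(** An algebra with such a pair is subdirectly irreducible: the pair generates its least
    nontrivial congruence. *)
Definition monolith (A : flw) (a b : A) : Prop :=
  a <> b /\ forall r, congruence r -> (exists x y, r x y /\ x <> y) -> r a b.

Lemma monolith_iso (A C : flw) (h : A -> C) (a b : A) :
    homomorphism h -> injective h -> (forall c, exists x, h x = c) ->
  monolith a b -> monolith (h a) (h b).
Proof.
move=> hh hi hs [ab mab]; split=> [/hi //|r rc [c [d [rcd cd]]]].
apply: (mab (fun x y => r (h x) (h y))); first exact: congruence_preim rc.
have [x xc] := hs c; have [y yd] := hs d.
by exists x, y; rewrite xc yd; split=> // xy; apply: cd; rewrite -xc -yd xy.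
Qed.

(** Birkhoff: the quotient by a congruence that is maximal among those that
    keep a and b apart. *)
Lemma monolith_quotient (A : flw) (a b : A) : a <> b ->
  exists (C : flw) (q : A -> C),
    [/\ homomorphism q, forall c, exists x, q x = c & monolith (q a) (q b)].
Proof.
move=> ab.
(* Adding the diagonal makes the empty set, the union of the empty chain, stand
   for the trivial congruence. *)
pose rel (X : set (A * A)) x y := x = y \/ X (x, y).
pose P := [set X : set (A * A) | congruence (rel X) /\ ~ rel X a b].
have [F FP Ft|X [[Xc Xab] Xmax]] := @Zorn_bigcup (A * A)%type P.
  have relE x y : rel (\bigcup_(X in F) X) x y -> x = y \/ exists2 X, F X & rel X x y.
    by move=> [|[X FX Xxy]]; [left|right; exists X => //; right].
  have relI X x y : F X -> rel X x y -> rel (\bigcup_(X in F) X) x y.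
    by move=> FX [|Xxy]; [left|right; exists X].
  have mono X Y x y : X `<=` Y -> rel X x y -> rel Y x y.
    by move=> XY [|/XY]; [left|right].
  have two x y z t : rel (\bigcup_(X in F) X) x y -> rel (\bigcup_(X in F) X) z t ->
      (x = y /\ z = t) \/ exists X, [/\ F X, rel X x y & rel X z t].
    move=> /relE[xy|[X FX Xxy]] /relE[zt|[Y FY Yzt]].
    - by left.
    - by right; exists Y; split=> //; left.
    - by right; exists X; split=> //; left.
    - right; have [XY|YX] := Ft _ _ FX FY.
        by exists Y; split=> //; apply: mono Xxy.
      by exists X; split=> //; apply: mono Yzt.
  have op f : (forall X, F X -> forall x x' y y',
      rel X x x' -> rel X y y' -> rel X (f x y) (f x' y')) ->
      forall x x' y y', rel (\bigcup_(X in F) X) x x' ->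
      rel (\bigcup_(X in F) X) y y' -> rel (\bigcup_(X in F) X) (f x y) (f x' y').
    move=> fX x x' y y' xx yy; have [[-> ->]|[X [FX Xx Xy]]] := two _ _ _ _ xx yy.
      by left.
    by apply: (relI X) => //; apply: fX.
  split; last first.
    by move=> /relE[//|[X FX Xab]]; have [_] := FP _ FX; apply.
  split.
  - by move=> x; left.
  - move=> x y /relE[->|[X FX Xxy]]; first by left.
    by apply: (relI X) => //; apply: cong_sym Xxy; have [] := FP _ FX.
  - move=> x y z xy yz; have [[-> ->]|[X [FX Xxy Xyz]]] := two _ _ _ _ xy yz.
      by left.
    by apply: (relI X) => //; apply: cong_trans Xxy Xyz; have [] := FP _ FX.
  - by apply: op => X /FP[Xc _]; apply: cong_meet.
  - by apply: op => X /FP[Xc _]; apply: cong_join.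
  - by apply: op => X /FP[Xc _]; apply: cong_mul.
  - by apply: op => X /FP[Xc _]; apply: cong_ldiv.
  - by apply: op => X /FP[Xc _]; apply: cong_rdiv.
exists (quot_flw Xc), (cls (rel X)); split.
- exact: cls_hom.
- exact: cls_surj.
split=> [/(clsE Xc) //|r rc [p [q [rpq pq]]]].
have [x xp] := cls_surj p; have [y yq] := cls_surj q; subst p q.
pose Y := [set u : A * A | r (cls (rel X) u.1) (cls (rel X) u.2)].
have YE z t : rel Y z t <-> r (cls (rel X) z) (cls (rel X) t).
  by split=> [[->|//]|rzt]; [apply: (cong_refl rc)|right].
have XY : X `<` Y.
  split=> [[z t] Xzt|YX].
    have /(clsE Xc) e : rel X z t by right.
    by rewrite /Y /= e; apply: (cong_refl rc).
  by apply: pq; apply/(clsE Xc); right; apply: YX.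
apply: contrapT => nab; apply: (Xmax Y XY); split; last by move/YE.
have -> : rel Y = fun z t => r (cls (rel X) z) (cls (rel X) t).
  by apply/funext => z; apply/funext => t; apply/propext/YE.
exact: congruence_preim (cls_hom Xc) rc.
Qed.

(** * Boolean elements of subdirectly irreducible algebras *)

Definition bot_top (A : flw) (b : two) : A := if b : bool then one else zero.

Lemma bot_top_hom A : homomorphism (bot_top A).
Proof.
have z1 (x : A) : ldiv zero x = one by apply/ldiv_eq1/zero_le.
have z2 (x : A) : rdiv x zero = one by apply/rdiv_eq1/zero_le.
have o1 (x : A) : ldiv x one = one by apply/ldiv_eq1/le_one.
have o2 (x : A) : rdiv one x = one by apply/rdiv_eq1/le_one.
have j0 (x : A) : join zero x = x by rewrite joinC join_zero.
have m0 (x : A) : meet zero x = zero by rewrite meetC meet_zero.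
split; last split; rewrite /bot_top //= => -[] [] /=;
  by rewrite ?(meetxx, joinxx, meet_zero, join_zero, join_one, j0, m0, mul_onel,
    mul_oner, mul_zero, zero_mul, ldiv_one, rdiv_one, z1, z2, o1, o2).
Qed.

Lemma bot_top_inj (A : flw) : (zero : A) <> one -> injective (bot_top A).
Proof. by move=> z1 [] [] //=; rewrite /bot_top => e; case: z1. Qed.

Lemma monolith_nontrivial (A : flw) (a b : A) : monolith a b -> (zero : A) <> one.
Proof.
by move=> [ab _] z1; apply: ab; rewrite -(meet_one a) -(meet_one b) -z1 !meet_zero.
Qed.

(** A nontrivial decomposition of A as a direct product gives two nontrivial
    congruences that meet trivially. *)
Lemma monolith_indecomposable (A : flw) (a b c d : A) : monolith a b ->
    congruence (fun x y => meet x c = meet y c) ->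
    congruence (fun x y => meet x d = meet y d) ->
    (forall x, x = join (meet x c) (meet x d)) ->
  c = one \/ d = one.
Proof.
move=> [ab mab] cc cd j; apply: contrapT => /not_orP[c1 d1].
have h e : congruence (fun x y => meet x e = meet y e) -> e <> one -> meet a e = meet b e.
  by move=> ec e1; apply: (mab _ ec); exists e, one; rewrite meetxx meetC meet_one.
by apply: ab; rewrite (j a) (j b) (h c) // (h d).
Qed.

Section Perfect.

(** In a perfect algebra, the square of an element of the lower part is zero
    and the negation of an element of the upper part is in the lower part, so
    that this term takes the value zero on the lower part and one on the upper
    part. *)
Definition boolpart_term (t : term) : term :=
  let s := Ldiv (Mul t t) Zero in Ldiv (Mul s s) Zero.

Definition boolpart (A : flw) (x : A) : A := eval (fun=> x) (boolpart_term (Var 0)).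

Lemma perfect_boolpart (A : flw) (h : A -> two) :
    homomorphism h -> (forall x y, h x = zero -> h y = one -> le x y) ->
  forall x, boolpart x = bot_top A (h x).
Proof.
move=> [hm hj hM hl [hr h0 h1]] hle.
have sq x : h x = false -> mul x x = zero.
  move=> hx; apply: le_anti (zero_le _); apply/ldiv_residual/hle => //.
  by rewrite hl hx h0.
have o0 : ldiv one zero = zero :> A by rewrite ldiv_one.
have z1 : ldiv zero zero = one :> A by apply/ldiv_eq1/le_refl.
move=> x; rewrite /boolpart /bot_top /=.
case hx: (h x : bool); last by rewrite (sq x) // z1 mul_oner o0.
by rewrite [mul _ (ldiv _ _)]sq ?z1 // hl hM hx h0.
Qed.

Lemma PPsiMV_eq (A : flw) (s t : term) (v : nat -> A) : PPsiMV A ->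
    (forall (C : flw) (h : C -> two) (w : nat -> C), pseudo_mv C -> homomorphism h ->
      (forall x y, h x = zero -> h y = one -> le x y) -> eval w s = eval w t) ->
  eval v s = eval v t.
Proof.
move=> PA st; have /generatedP /(_ (s, t)) := PA; apply=> C [Cmv [h [hh hle]]] w.
exact: st Cmv hh hle.
Qed.

Variables (A : flw) (PA : PPsiMV A).

Definition env3 (x y z : A) (n : nat) : A :=
  match n with 0 => x | 1 => y | _ => z end.

Lemma PPsiMV_pseudo_mv : pseudo_mv A.
Proof.
move=> x y; split.
- apply: (@PPsiMV_eq A (Rdiv (Var 0) (Ldiv (Var 1) (Var 0))) (Join (Var 0) (Var 1))
    (env3 x y x)) => // C h w Cmv _ _ /=.
  by have [] := Cmv (w 0) (w 1).
- apply: (@PPsiMV_eq A (Join (Var 0) (Var 1)) (Ldiv (Rdiv (Var 0) (Var 1)) (Var 0))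
    (env3 x y x)) => // C h w Cmv _ _ /=.
  by have [] := Cmv (w 0) (w 1).
Qed.

Lemma boolpart_op (f : term -> term -> term) (g : forall C : flw, C -> C -> C) :
    (forall (C : flw) (v : nat -> C) s t, eval v (f s t) = g C (eval v s) (eval v t)) ->
    (forall (C D : flw) (h : C -> D), homomorphism h -> {morph h : x y / g C x y >-> g D x y}) ->
  forall x y, boolpart (g A x y) = g A (boolpart x) (boolpart y).
Proof.
move=> fE gM x y.
have := @PPsiMV_eq A (boolpart_term (f (Var 0) (Var 1))) (f (boolpart_term (Var 0)) (boolpart_term (Var 1)))
  (env3 x y x) PA.
rewrite /boolpart_term /= !fE /=; apply=> C h w _ hh hle /=; rewrite !fE /=.
have bE := perfect_boolpart hh hle.
rewrite -[LHS]/(boolpart (g C (w 0) (w 1))) -[RHS]/(g C (boolpart (w 0)) (boolpart (w 1))).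
by rewrite !bE (gM _ _ _ hh) (gM _ _ _ (bot_top_hom C)).
Qed.

(** If, in perfect algebras, a term in the Boolean part takes only the values zero and
    one, then cutting down by its value commutes with all operations there; this is
    a set of equations, so that it also holds in A. *)
Lemma boolpart_congruence (u : term -> term) (z : A) :
    (forall (C : flw) (h : C -> two) (w : nat -> C), homomorphism h ->
      (forall x y, h x = zero -> h y = one -> le x y) ->
      exists b, eval w (u (boolpart_term (Var 2))) = bot_top C b) ->
  let c := eval (fun=> z) (u (boolpart_term (Var 2))) in
  (forall x y, eval (env3 x y z) (u (boolpart_term (Var 2))) = c) ->
  congruence (fun x y => meet x c = meet y c).
Proof.
move=> uP c cE.
have key (f : term -> term -> term) (g : A -> A -> A) :
    (forall (C : flw) (w : nat -> C) s s' t t', eval w s = eval w s' ->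
      eval w t = eval w t' -> eval w (f s t) = eval w (f s' t')) ->
    (forall v s t, eval v (f s t) = g (eval v s) (eval v t)) ->
    forall x x' y y', meet x c = meet x' c -> meet y c = meet y' c ->
    meet (g x y) c = meet (g x' y') c.
  move=> fext fE.
  have cut x y : meet (g x y) c = meet (g (meet x c) (meet y c)) c.
    have := @PPsiMV_eq A (Meet (f (Var 0) (Var 1)) (u (boolpart_term (Var 2))))
      (Meet (f (Meet (Var 0) (u (boolpart_term (Var 2)))) (Meet (Var 1) (u (boolpart_term (Var 2)))))
         (u (boolpart_term (Var 2)))) (env3 x y z) PA.
    rewrite /= !fE /= !cE; apply=> C h w _ hh hle.
    have [b bE] := uP C h w hh hle.
    rewrite /= !bE; case: b bE => bE; rewrite /bot_top ?meet_zero // !meet_one.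
    by apply: fext; rewrite /= bE meet_one.
  by move=> x x' y y' xx yy; rewrite cut xx yy -cut.
split=> //; first by move=> x y w -> ->.
- by apply: (key Meet) => //= C w s s' t t' -> ->.
- by apply: (key Join) => //= C w s s' t t' -> ->.
- by apply: (key Mul) => //= C w s s' t t' -> ->.
- by apply: (key Ldiv) => //= C w s s' t t' -> ->.
- by apply: (key Rdiv) => //= C w s s' t t' -> ->.
Qed.

Variables (a b : A) (mab : monolith a b).

(** The Boolean part of z and its negation give complementary factor congruences, one
    of which is trivial. *)
Lemma monolith_boolpart (z : A) : boolpart z = zero \/ boolpart z = one.
Proof.
pose n t := Ldiv t Zero.
have z1 (C : flw) : ldiv zero zero = one :> C by apply/ldiv_eq1/le_refl.
have c1 : congruence (fun x y => meet x (boolpart z) = meet y (boolpart z)).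
  apply: (@boolpart_congruence id z) => // C h w hh hle.
  by exists (h (w 2)); rewrite -perfect_boolpart.
have c2 : congruence (fun x y => meet x (ldiv (boolpart z) zero) =
    meet y (ldiv (boolpart z) zero)).
  apply: (@boolpart_congruence n z) => // C h w hh hle.
  rewrite -[eval _ _]/(ldiv (boolpart (w 2)) (zero : C)) (perfect_boolpart hh) //.
  by exists (~~ h (w 2)); case: (h (w 2) : bool) => /=; rewrite /bot_top ?ldiv_one ?z1.
have [x||/ldiv_eq1 z0] := monolith_indecomposable mab c1 c2.
- pose t := boolpart_term (Var 2).
  apply: (@PPsiMV_eq A (Var 0) (Join (Meet (Var 0) t) (Meet (Var 0) (n t))) (env3 x x z)) => //.
  move=> C h w _ hh hle.
  rewrite -[RHS]/(join (meet (w 0) (boolpart (w 2)))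
    (meet (w 0) (ldiv (boolpart (w 2)) (zero : C)))) (perfect_boolpart hh) //.
  case: (h (w 2) : bool); rewrite /bot_top ?ldiv_one ?z1 meet_one meet_zero ?join_zero //.
  by rewrite joinC join_zero.
- by right.
- by left; apply: le_anti z0 (zero_le _).
Qed.

(** That the Boolean part commutes with the operations and separates the two parts
    of a perfect algebra is a set of equations. As the values of the Boolean part in A
    are zero and one, they say that it is a homomorphism as required. *)
Lemma monolith_perfect : perfect A.
Proof.
have inj := bot_top_inj (monolith_nontrivial mab).
have /choice[h hE] (x : A) : exists b, boolpart x = bot_top A b.
  by have [->|->] := monolith_boolpart x; [exists false|exists true].
have [bm bj bM bl [br b0 b1]] := bot_top_hom A.
have z1 : ldiv zero zero = one :> A by apply/ldiv_eq1/le_refl.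
exists h; split; [split; last split|].
- move=> x y; apply: inj; rewrite bm -!hE.
  by apply: (@boolpart_op Meet (fun C => @meet C)) => // C D g [].
- move=> x y; apply: inj; rewrite bj -!hE.
  by apply: (@boolpart_op Join (fun C => @join C)) => // C D g [].
- move=> x y; apply: inj; rewrite bM -!hE.
  by apply: (@boolpart_op Mul (fun C => @mul C)) => // C D g [].
- move=> x y; apply: inj; rewrite bl -!hE.
  by apply: (@boolpart_op Ldiv (fun C => @ldiv C)) => // C D g [].
- move=> x y; apply: inj; rewrite br -!hE.
  by apply: (@boolpart_op Rdiv (fun C => @rdiv C)) => // C D g [_ _ _ _ []].
- by apply: inj; rewrite -hE /boolpart /= mul_zero z1 mul_oner ldiv_one.
- by apply: inj; rewrite -hE /boolpart /= mul_oner ldiv_one mul_zero z1.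
- move=> x y hx hy.
  suff : meet (meet x (boolpart y)) (join y (boolpart x)) = meet x (boolpart y).
    by rewrite !hE hx hy b0 b1 meet_one join_zero.
  pose t i := boolpart_term (Var i).
  apply: (@PPsiMV_eq A (Meet (Meet (Var 0) (t 1)) (Join (Var 1) (t 0)))
    (Meet (Var 0) (t 1)) (env3 x y x)) => // C g w _ gh gle.
  rewrite -[RHS]/(meet (w 0) (boolpart (w 1))).
  rewrite -[LHS]/(meet (meet (w 0) (boolpart (w 1))) (join (w 1) (boolpart (w 0)))).
  rewrite !(perfect_boolpart gh) // /bot_top.
  case g1: (g (w 1) : bool); last by rewrite meet_zero meetC meet_zero.
  case g0: (g (w 0) : bool); first by rewrite join_one meet_one.
  by rewrite meet_one join_zero; apply: gle.
Qed.

End Perfect.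

(** * Lattice-ordered groups *)

Section LGroup.
Variable L : lgroup.
Implicit Types x y z : L.

Lemma ginv_uniq x y : gmul x y = gone -> y = ginv x.
Proof. by move=> e; rewrite -(gmulI x y) e gmul_oner. Qed.

Lemma ginvK x : ginv (ginv x) = x.
Proof. by apply/esym/ginv_uniq/gmul_invl. Qed.

Lemma ginv1 : ginv gone = gone :> L.
Proof. by apply/esym/ginv_uniq/gmul_onel. Qed.

Lemma ginvM x y : ginv (gmul x y) = gmul (ginv y) (ginv x).
Proof. by apply/esym/ginv_uniq; rewrite -gmul_assoc gmulKV gmul_invr. Qed.

Lemma gmul_inv_eq1 x y : gmul x (ginv y) = gone <-> x = y.
Proof. by split=> [e|->]; rewrite ?gmul_invr // -(gmulVK y x) e gmul_onel. Qed.

Lemma ginv_le x y : le (ginv y) (ginv x) <-> le x y.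
Proof.
have h z t : le z t -> le (ginv t) (ginv z).
  move=> zt; rewrite -(gmul_onel (ginv z)); apply/gmul_leR.
  by rewrite -(gmul_invl t); apply: gmul_le2l.
by split=> [/h|/h //]; rewrite !ginvK.
Qed.

Lemma ginv_meet x y : ginv (meet x y) = join (ginv x) (ginv y).
Proof.
apply: le_anti.
  by rewrite -ginv_le ginvK; apply/le_meet; split; rewrite -ginv_le ginvK;
    [apply: join_gel|apply: join_ger].
by apply/join_le; rewrite !ginv_le; split; [apply: meet_lel|apply: meet_ler].
Qed.

Lemma ginv_join x y : ginv (join x y) = meet (ginv x) (ginv y).
Proof. by rewrite -(ginvK (meet _ _)) ginv_meet !ginvK. Qed.

Lemma gmul_meet x y z : gmul x (meet y z) = meet (gmul x y) (gmul x z).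
Proof. by rewrite -[LHS]ginvK ginvM ginv_meet join_gmul ginv_join !ginvM !ginvK. Qed.

Lemma meet_gmul x y z : gmul (meet y z) x = meet (gmul y x) (gmul z x).
Proof. by rewrite -[LHS]ginvK ginvM ginv_meet gmul_join ginv_join !ginvM !ginvK. Qed.

End LGroup.

(** * The group of fractions of a cancellative cone *)

(** The negative cones of lattice-ordered groups, axiomatized by cancellation and
    divisibility. *)
Record cone := Cone {
  cone_lat :> lattice;
  cmul : cone_lat -> cone_lat -> cone_lat;
  cone1 : cone_lat;
  cmulA : associative cmul;
  cmul1l : left_id cone1 cmul;
  cmul1r : right_id cone1 cmul;
  cmulI : forall x, injective (cmul x);
  cmulIr : forall x y z, cmul y x = cmul z x -> y = z;
  cle_l : forall x y, le x y <-> exists z, x = cmul y z;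
  cle_r : forall x y, le x y <-> exists z, x = cmul z y }.

Arguments cone1 {c}.
Local Notation "x ** y" := (cmul x y) (at level 40, left associativity).

Section Fractions.
Variable F : cone.
Implicit Types x y z t u v w p q : F.

Lemma cmul_le2r z x y : le x y <-> le (x ** z) (y ** z).
Proof.
split=> [/cle_r[t ->]|/cle_r[t]]; first by apply/cle_r; exists t; rewrite cmulA.
by rewrite cmulA => /cmulIr ->; apply/cle_r; exists t.
Qed.

Lemma cmul_ler x y : le (x ** y) y. Proof. by apply/cle_r; exists x. Qed.

Lemma cmul_lel x y : le (x ** y) x. Proof. by apply/cle_l; exists y. Qed.

Lemma meet_cmul x y z : meet x y ** z = meet (x ** z) (y ** z).
Proof.
apply: le_anti.
  by apply/le_meet; rewrite -!cmul_le2r; split; [apply: meet_lel|apply: meet_ler].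
have /cle_r[t tE] := le_trans (meet_lel (x ** z) (y ** z)) (cmul_ler x z).
rewrite tE -cmul_le2r; apply/le_meet; rewrite (cmul_le2r z t x) (cmul_le2r z t y) -tE.
by split; [apply: meet_lel|apply: meet_ler].
Qed.

Lemma join_cmul x y z : join x y ** z = join (x ** z) (y ** z).
Proof.
apply: le_anti; last first.
  by apply/join_le; rewrite -!cmul_le2r; split; [apply: join_gel|apply: join_ger].
have /cle_r[t tE] : le (join (x ** z) (y ** z)) z.
  by apply/join_le; split; apply: cmul_ler.
rewrite tE -cmul_le2r; apply/join_le; rewrite (cmul_le2r z x t) (cmul_le2r z y t) -tE.
by split; [apply: join_gel|apply: join_ger].
Qed.

Lemma ore x y : exists u v, x ** u = y ** v.
Proof.
have /cle_l[u uE] := meet_lel x y; have /cle_l[v vE] := meet_ler x y.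
by exists u, v; rewrite -uE.
Qed.

(** A fraction g is represented by the set of all pairs y, z with y = g z. These
    sets are the nonempty graphs of partial injections that are closed under
    simultaneous right multiplication and right cancellation. *)
Record is_frac (R : F -> F -> Prop) : Prop := IsFrac {
  frac_mul : forall w y z, R y z -> R (y ** w) (z ** w);
  frac_cancel : forall w y z, R (y ** w) (z ** w) -> R y z;
  frac_fun : forall y y' z, R y z -> R y' z -> y = y';
  frac_inj : forall y z z', R y z -> R y z' -> z = z';
  frac_ex : exists y z, R y z }.

Definition frac := {R : F -> F -> Prop | is_frac R}.
Definition frac_rel (f : frac) : F -> F -> Prop := sval f.
Coercion frac_rel : frac >-> Funclass.
Implicit Types f g h : frac.

Lemma fracP f : is_frac f. Proof. exact: proj2_sig f. Qed.

Lemma frac_eq f g y z : f y z -> g y z -> f = g.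
Proof.
have half f' g' a b : f' y z -> g' y z -> f' a b -> g' a b.
  move=> fyz gyz fab; have [u [v e]] := ore z b.
  apply: (frac_cancel (fracP g') (w := v)); rewrite -e.
  have -> : a ** v = y ** u; last exact: frac_mul (fracP g') _ _ _ gyz.
  apply: (frac_fun (fracP f')) (frac_mul (fracP f') v fab) _.
  by rewrite -e; apply: frac_mul (fracP f') _ _ _ fyz.
case: f g half => [R Rf] [S Sf] half Ryz Syz; apply: eq_exist.
apply/funext => a; apply/funext => b; apply/propext.
by split; [apply: (half (exist _ R Rf) (exist _ S Sf))
          |apply: (half (exist _ S Sf) (exist _ R Rf))].
Qed.

Lemma frac_common f g : exists x y z, f x z /\ g y z.
Proof.
have [x [z fxz]] := frac_ex (fracP f); have [y [t gyt]] := frac_ex (fracP g).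
have [u [v e]] := ore z t; exists (x ** u), (y ** v), (z ** u); split.
  exact: frac_mul (fracP f) _ _ _ fxz.
by rewrite e; apply: frac_mul (fracP g) _ _ _ gyt.
Qed.

Lemma frac_common3 f g h : exists x y z t, [/\ f x t, g y t & h z t].
Proof.
have [x [y [t [fx gy]]]] := frac_common f g.
have [z [s hz]] := frac_ex (fracP h).
have [u [v e]] := ore t s; exists (x ** u), (y ** u), (z ** v), (t ** u); split.
- exact: frac_mul (fracP f) _ _ _ fx.
- exact: frac_mul (fracP g) _ _ _ gy.
- by rewrite e; apply: frac_mul (fracP h) _ _ _ hz.
Qed.

(** An operation that commutes with right multiplication is applied to fractions over
    a common denominator. *)
Section Pointwise.
Variables (op : F -> F -> F) (opM : forall x y z, op x y ** z = op (x ** z) (y ** z)).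

Lemma is_frac_op f g : is_frac (fun y z =>
  exists u a b, [/\ f a (z ** u), g b (z ** u) & y ** u = op a b]).
Proof.
have fM := frac_mul (fracP f); have gM := frac_mul (fracP g).
split.
- move=> w y z [u [a [b [fa gb e]]]]; have [p [q pq]] := ore u w.
  exists q, (a ** p), (b ** p).
  by rewrite -!cmulA -pq !cmulA e opM; split=> //; [apply: fM|apply: gM].
- move=> w y z [u [a [b [fa gb e]]]].
  by exists (w ** u), a, b; rewrite !cmulA.
- move=> y y' z [u [a [b [fa gb e]]]] [u' [a' [b' [fa' gb' e']]]].
  have [p [q pq]] := ore u u'.
  apply: (@cmulIr F (u ** p)); rewrite {2}pq !cmulA e e' !opM.
  have zpq : z ** u ** p = z ** u' ** q by rewrite -!cmulA pq.
  congr op.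
    by apply: (frac_fun (fracP f)) (fM p _ _ fa) _; rewrite zpq; apply: fM.
  by apply: (frac_fun (fracP g)) (gM p _ _ gb) _; rewrite zpq; apply: gM.
- move=> y z z' [u [a [b [fa gb e]]]] [u' [a' [b' [fa' gb' e']]]].
  have [p [q pq]] := ore u u'; have [s [s' ss]] := ore (z ** u ** p) (z' ** u' ** q).
  have ea : a ** p ** s = a' ** q ** s'.
    apply: (frac_fun (fracP f)) (fM s _ _ (fM p _ _ fa)) _.
    by rewrite ss; apply: fM (fM _ _ _ fa').
  have eb : b ** p ** s = b' ** q ** s'.
    apply: (frac_fun (fracP g)) (gM s _ _ (gM p _ _ gb)) _.
    by rewrite ss; apply: gM (gM _ _ _ gb').
  have es : s = s'.
    apply: (@cmulI F (y ** u ** p)); rewrite e !opM ea eb -!opM -e'.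
    by rewrite -(cmulA y) -pq cmulA e opM.
  by move: ss; rewrite -{}es => /cmulIr; rewrite -!cmulA -pq => /cmulIr.
- have [a [b [z [fa gb]]]] := frac_common f g.
  by exists (op a b), z, cone1, a, b; rewrite !cmul1r.
Qed.

Definition frac_op f g : frac := exist _ _ (is_frac_op f g).

Lemma frac_opP f g a b z : f a z -> g b z -> frac_op f g (op a b) z.
Proof. by move=> fa gb; exists cone1, a, b; rewrite !cmul1r. Qed.

End Pointwise.

Definition frac_meet := frac_op meet_cmul.
Definition frac_join := frac_op join_cmul.

Lemma frac_meetC : commutative frac_meet.
Proof.
move=> f g; have [a [b [z [fa gb]]]] := frac_common f g.
apply: (@frac_eq _ _ (meet a b) z); first exact: frac_opP.
by rewrite meetC; apply: frac_opP.
Qed.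

Lemma frac_joinC : commutative frac_join.
Proof.
move=> f g; have [a [b [z [fa gb]]]] := frac_common f g.
apply: (@frac_eq _ _ (join a b) z); first exact: frac_opP.
by rewrite joinC; apply: frac_opP.
Qed.

Lemma frac_meetA : associative frac_meet.
Proof.
move=> f g h; have [a [b [c [z [fa gb hc]]]]] := frac_common3 f g h.
apply: (@frac_eq _ _ (meet a (meet b c)) z); first by do 2?[apply: frac_opP].
by rewrite meetA; do 2?[apply: frac_opP].
Qed.

Lemma frac_joinA : associative frac_join.
Proof.
move=> f g h; have [a [b [c [z [fa gb hc]]]]] := frac_common3 f g h.
apply: (@frac_eq _ _ (join a (join b c)) z); first by do 2?[apply: frac_opP].
by rewrite joinA; do 2?[apply: frac_opP].
Qed.

Lemma frac_meet_joinK f g : frac_meet f (frac_join f g) = f.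
Proof.
have [a [b [z [fa gb]]]] := frac_common f g; apply: (@frac_eq _ _ a z) => //.
by rewrite -{1}(meet_joinK a b); apply: frac_opP => //; apply: frac_opP.
Qed.

Lemma frac_join_meetK f g : frac_join f (frac_meet f g) = f.
Proof.
have [a [b [z [fa gb]]]] := frac_common f g; apply: (@frac_eq _ _ a z) => //.
by rewrite -{1}(join_meetK a b); apply: frac_opP => //; apply: frac_opP.
Qed.

Definition frac_lattice : lattice :=
  Lattice frac_meetC frac_joinC frac_meetA frac_joinA frac_meet_joinK frac_join_meetK.

Lemma frac_leE f g a b z : f a z -> g b z ->
  le (f : frac_lattice) g <-> le a b.
Proof.
move=> fa gb; split=> h.
  have m : frac_meet f g (meet a b) z by apply: frac_opP.
  by rewrite [frac_meet f g]h in m; apply: (frac_fun (fracP f)) m fa.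
apply: (@frac_eq (frac_meet f g) f a z) => //.
by rewrite -{1}h; apply: frac_opP.
Qed.

(** The composite of the partial injections need not have the whole graph of the
    product, hence the closure under right cancellation. *)
Lemma is_frac_mul f g : is_frac (fun y z => exists u t, f (y ** u) t /\ g t (z ** u)).
Proof.
have fM := frac_mul (fracP f); have gM := frac_mul (fracP g).
split.
- move=> w y z [u [t [ft gt]]]; have [p [q pq]] := ore u w.
  exists q, (t ** p); rewrite -!cmulA -pq !cmulA.
  by split; [apply: fM|apply: gM].
- by move=> w y z [u [t [ft gt]]]; exists (w ** u), t; rewrite !cmulA.
- move=> y y' z [u [t [ft gt]]] [u' [t' [ft' gt']]]; have [p [q pq]] := ore u u'.
  have tE : t ** p = t' ** q.
    by apply: (frac_fun (fracP g)) (gM p _ _ gt) _; rewrite -cmulA pq cmulA; apply: gM.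
  apply: (@cmulIr F (u ** p)); rewrite {2}pq !cmulA.
  by apply: (frac_fun (fracP f)) (fM p _ _ ft) _; rewrite tE; apply: fM.
- move=> y z z' [u [t [ft gt]]] [u' [t' [ft' gt']]]; have [p [q pq]] := ore u u'.
  have tE : t ** p = t' ** q.
    by apply: (frac_inj (fracP f)) (fM p _ _ ft) _; rewrite -cmulA pq cmulA; apply: fM.
  apply: (@cmulIr F (u ** p)); rewrite {2}pq !cmulA.
  by apply: (frac_inj (fracP g)) (gM p _ _ gt) _; rewrite tE; apply: gM.
- have [y [t ft]] := frac_ex (fracP f); have [s [z gsz]] := frac_ex (fracP g).
  have [u [v uv]] := ore t s; exists (y ** u), (z ** v), cone1, (t ** u).
  by rewrite !cmul1r; split; [apply: fM|rewrite uv; apply: gM].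
Qed.

Definition frac_gmul f g : frac := exist _ _ (is_frac_mul f g).

Lemma frac_gmulP f g y t z : f y t -> g t z -> frac_gmul f g y z.
Proof. by move=> ft gt; exists cone1, t; rewrite !cmul1r. Qed.

Lemma frac_chain f g : exists y t z, f y t /\ g t z.
Proof.
have [y [t fyt]] := frac_ex (fracP f); have [s [z gsz]] := frac_ex (fracP g).
have [u [v uv]] := ore t s; exists (y ** u), (t ** u), (z ** v).
by split; [apply: frac_mul (fracP f) _ _ _ fyt|rewrite uv; apply: frac_mul (fracP g) _ _ _ gsz].
Qed.

Lemma is_frac1 : is_frac eq.
Proof. by split=> [w y z -> //|w y z /cmulIr //|y y' z -> //|y z z' -> //|]; exists cone1, cone1. Qed.

Definition frac_one : frac := exist _ _ is_frac1.

Lemma is_frac_inv f : is_frac (fun y z => f z y).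
Proof.
have [m c fu i [y [z fyz]]] := fracP f.
split=> [w ? ? /m //|w ? ? /c //|? ? ? ? ?|? ? ? ? ?|]; last by exists z, y.
- by apply: i; eassumption.
- by apply: fu; eassumption.
Qed.

Definition frac_inv f : frac := exist _ _ (is_frac_inv f).

Lemma frac_gmulA : associative frac_gmul.
Proof.
move=> f g h; have [y [t [s [ft gs]]]] := frac_chain f g.
have [s' [z hz]] := frac_ex (fracP h); have [u [v uv]] := ore s s'.
have {}ft := frac_mul (fracP f) u ft; have {}gs := frac_mul (fracP g) u gs.
have {}hz := frac_mul (fracP h) v hz; rewrite -uv in hz.
apply: (@frac_eq _ _ (y ** u) (z ** v)).
  by apply: frac_gmulP ft _; apply: frac_gmulP gs hz.
by apply: frac_gmulP _ hz; apply: frac_gmulP ft gs.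
Qed.

Lemma frac_gmul1 : left_id frac_one frac_gmul.
Proof.
move=> f; have [y [z fyz]] := frac_ex (fracP f).
by apply: (@frac_eq _ _ y z) => //; apply: (@frac_gmulP _ _ _ y).
Qed.

Lemma frac_gmulV : left_inverse frac_one frac_inv frac_gmul.
Proof.
move=> f; have [y [z fyz]] := frac_ex (fracP f).
by apply: (@frac_eq _ _ z z) => //; apply: (@frac_gmulP _ _ _ y).
Qed.

Lemma frac_le2l (h f g : frac_lattice) :
  le f g -> le (frac_gmul h f : frac_lattice) (frac_gmul h g).
Proof.
move=> fg; have [p [s [t [hp gs]]]] := frac_chain h g.
have [x [t' fx]] := frac_ex (fracP f); have [u [v uv]] := ore t t'.
have {}hp := frac_mul (fracP h) u hp; have {}gs := frac_mul (fracP g) u gs.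
have {}fx := frac_mul (fracP f) v fx; rewrite -uv in fx.
have /(frac_leE fx gs)/cle_l[c cE] := fg; rewrite cE in fx.
rewrite (frac_leE (frac_gmulP (frac_mul (fracP h) c hp) fx) (frac_gmulP hp gs)).
exact: cmul_lel.
Qed.

Lemma frac_le2r (h f g : frac_lattice) :
  le f g -> le (frac_gmul f h : frac_lattice) (frac_gmul g h).
Proof.
move=> fg; have [a [s [t [fa hs]]]] := frac_chain f h.
have [b [s' gb]] := frac_ex (fracP g); have [u [v uv]] := ore s s'.
have {}fa := frac_mul (fracP f) u fa; have {}hs := frac_mul (fracP h) u hs.
have {}gb := frac_mul (fracP g) v gb; rewrite -uv in gb.
by rewrite (frac_leE (frac_gmulP fa hs) (frac_gmulP gb hs)) -(frac_leE fa gb).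
Qed.

Definition frac_lgroup : lgroup :=
  @LGroup frac_lattice frac_gmul frac_inv frac_one
    frac_gmulA frac_gmul1 frac_gmulV frac_le2l frac_le2r.

Lemma is_frac_of x : is_frac (fun y z => y = x ** z).
Proof.
split=> [w y z ->|w y z|y y' z -> -> //|y z z' -> /cmulI //|].
- by rewrite cmulA.
- by rewrite cmulA => /cmulIr.
- by exists (x ** cone1), cone1.
Qed.

Definition to_frac x : frac_lgroup := exist _ _ (is_frac_of x).

Lemma to_fracP x : (to_frac x : frac) x cone1. Proof. by rewrite /= cmul1r. Qed.

Lemma to_frac_le x y : le (to_frac x) (to_frac y) <-> le x y.
Proof. exact: frac_leE (to_fracP x) (to_fracP y). Qed.

Lemma to_fracM x y : to_frac (x ** y) = gmul (to_frac x) (to_frac y).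
Proof.
apply: (@frac_eq _ _ (x ** y) cone1); first exact: to_fracP.
by apply: (@frac_gmulP _ _ _ y); rewrite //= cmul1r.
Qed.

Lemma to_frac1 : to_frac cone1 = gone.
Proof. by apply: (@frac_eq _ _ cone1 cone1); first exact: to_fracP. Qed.

Lemma to_frac_le1 x : le (to_frac x) gone.
Proof. by rewrite -to_frac1 to_frac_le -(cmul1r x); apply: cmul_ler. Qed.

Lemma to_frac_surj (f : frac_lgroup) : le f gone -> exists x, f = to_frac x.
Proof.
have [y [z fyz]] := frac_ex (fracP f).
rewrite (frac_leE fyz (erefl : frac_one z z)) => /cle_r[x xE].
by exists x; apply: (@frac_eq _ _ y z).
Qed.

Section Automorphism.
Variables (s si : F -> F) (sK : cancel s si) (siK : cancel si s).
Hypothesis sM : {morph s : x y / x ** y}.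

Lemma cone_inv_morph : {morph si : x y / x ** y}.
Proof. by move=> x y; apply: (can_inj sK); rewrite sM !siK. Qed.

Lemma cone_aut_le x y : le x y <-> le (s x) (s y).
Proof.
split=> /cle_l[z zE]; apply/cle_l; first by exists (s z); rewrite zE sM.
by exists (si z); apply: (can_inj sK); rewrite sM siK.
Qed.

Lemma cone_aut_meet : {morph s : x y / meet x y}.
Proof.
by move=> x y; apply: le_ext => z; rewrite le_meet -{1 2 3}(siK z) -!cone_aut_le le_meet.
Qed.

Lemma cone_aut_join : {morph s : x y / join x y}.
Proof.
move=> x y; apply: le_anti; last first.
  by apply/join_le; rewrite -!cone_aut_le; split; [apply: join_gel|apply: join_ger].
rewrite -(siK (join (s x) (s y))) -cone_aut_le; apply/join_le.
by split; rewrite cone_aut_le siK; [apply: join_gel|apply: join_ger].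
Qed.

End Automorphism.

Section FractionAutomorphism.
Variables (s si : F -> F) (sK : cancel s si) (siK : cancel si s).
Hypothesis sM : {morph s : x y / x ** y}.

Lemma is_frac_preim (r ri : F -> F) f : cancel r ri -> cancel ri r ->
  {morph r : x y / x ** y} -> is_frac (fun y z => f (r y) (r z)).
Proof.
move=> rK riK rM; have [m c fu i [y [z fyz]]] := fracP f; split.
- by move=> w a b ab; rewrite !rM; apply: m.
- by move=> w a b; rewrite !rM; apply: c.
- by move=> a b z' az bz; apply: (can_inj rK); apply: fu az bz.
- by move=> a b c' ab ac; apply: (can_inj rK); apply: i ab ac.
- by exists (ri y), (ri z); rewrite !riK.
Qed.

Definition frac_aut_fun (f : frac_lgroup) : frac_lgroup :=
  exist _ _ (is_frac_preim f siK sK (cone_inv_morph sK siK sM)).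
Definition frac_aut_inv (f : frac_lgroup) : frac_lgroup :=
  exist _ _ (is_frac_preim f sK siK sM).

Lemma frac_autP f y z : f y z -> (frac_aut_fun f : frac) (s y) (s z).
Proof. by rewrite /= !sK. Qed.

Lemma frac_autK : cancel frac_aut_fun frac_aut_inv.
Proof.
move=> f; have [y [z fyz]] := frac_ex (fracP f).
by apply: (@frac_eq _ _ y z) => //=; rewrite !sK.
Qed.

Lemma frac_aut_invK : cancel frac_aut_inv frac_aut_fun.
Proof.
move=> f; have [y [z fyz]] := frac_ex (fracP f).
by apply: (@frac_eq _ _ y z) => //=; rewrite !siK.
Qed.

Lemma frac_autM : {morph frac_aut_fun : f g / gmul f g}.
Proof.
move=> f g; have [y [t [z [fy gz]]]] := frac_chain f g.
apply: (@frac_eq _ _ (s y) (s z)); first by apply/frac_autP/(frac_gmulP fy gz).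
by apply: frac_gmulP (frac_autP fy) (frac_autP gz).
Qed.

Lemma frac_aut_meet : {morph frac_aut_fun : f g / meet f g}.
Proof.
move=> f g; have [a [b [z [fa gb]]]] := frac_common f g.
apply: (@frac_eq _ _ (s (meet a b)) (s z)); first by apply/frac_autP/(frac_opP _ fa gb).
by rewrite (cone_aut_meet sK siK sM); apply: frac_opP (frac_autP fa) (frac_autP gb).
Qed.

Lemma frac_aut_join : {morph frac_aut_fun : f g / join f g}.
Proof.
move=> f g; have [a [b [z [fa gb]]]] := frac_common f g.
apply: (@frac_eq _ _ (s (join a b)) (s z)); first by apply/frac_autP/(frac_opP _ fa gb).
by rewrite (cone_aut_join sK siK sM); apply: frac_opP (frac_autP fa) (frac_autP gb).
Qed.

Definition frac_aut : lgroup_aut frac_lgroup :=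
  LGroupAut frac_autK frac_aut_invK frac_autM frac_aut_meet frac_aut_join.

Lemma frac_aut_of x : frac_aut (to_frac x) = to_frac (s x).
Proof.
apply: (@frac_eq _ _ (s x) (s cone1)); first exact/frac_autP/to_fracP.
by rewrite /= -sM cmul1r.
Qed.

End FractionAutomorphism.
End Fractions.

(** * The algebras K(L, lambda) *)

(** Every element of K(L, lambda) is [meet_neg x] or [join_pos x] for some x in L;
    these two total maps let one compute in K(L, lambda) without carrying proofs
    that elements lie in a cone. *)
Section ConeAlgebra.
Variables (L : lgroup) (lam : lgroup_aut L).
Implicit Types x y : L.
Local Notation neg x := (meet_neg x : cone_flw lam).
Local Notation pos x := (join_pos x : cone_flw lam).

Variant cone_spec : cone_flw lam -> Prop :=
  | ConeNeg x of le x gone : cone_spec (neg x)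
  | ConePos x of le gone x : cone_spec (pos x).

Lemma coneP c : cone_spec c.
Proof.
case: c => [[x x1]|[x x1]].
  have -> : inl (exist _ x x1) = neg x by apply: inl_eq; rewrite /= x1.
  by constructor.
have -> : inr (exist _ x x1) = pos x.
  by apply: inr_eq; rewrite /= joinC; apply/esym/le_joinE.
by constructor.
Qed.

Let m1 x : le x gone -> meet x gone = x. Proof. by []. Qed.
Let j1 x : le gone x -> join x gone = x. Proof. by rewrite joinC => /le_joinE. Qed.

Lemma join_posK x : pos (join x gone) = pos x.
Proof. by apply: inr_eq; rewrite /= -joinA joinxx. Qed.

Lemma mul_neg_neg x y : le x gone -> le y gone -> mul (neg x) (neg y) = neg (gmul x y).
Proof. by move=> x1 y1; apply: inl_eq; rewrite /= !m1 //; apply: gmul_le1. Qed.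

Lemma mul_neg_pos x y : le x gone -> le gone y -> mul (neg x) (pos y) = pos (gmul (lam x) y).
Proof. by move=> x1 y1; apply: inr_eq; rewrite /= (m1 x1) (j1 y1). Qed.

Lemma mul_pos_neg x y : le gone x -> le y gone -> mul (pos x) (neg y) = pos (gmul x y).
Proof. by move=> x1 y1; apply: inr_eq; rewrite /= (j1 x1) (m1 y1). Qed.

Lemma zero_pos : zero = pos gone. Proof. by apply: inr_eq; rewrite /= joinxx. Qed.

Lemma le_neg_neg x y : le x gone -> le y gone -> le (neg x) (neg y) <-> le x y.
Proof. by move=> x1 y1; rewrite cone_leE /= (m1 x1) (m1 y1). Qed.

Lemma le_pos_pos x y : le gone x -> le gone y -> le (pos x) (pos y) <-> le x y.
Proof. by move=> x1 y1; rewrite cone_leE /= (j1 x1) (j1 y1). Qed.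

Lemma le_neg_pos x y : ~ le (neg x) (pos y). Proof. by rewrite cone_leE. Qed.
Lemma le_pos_neg x y : le (pos x) (neg y). Proof. by rewrite cone_leE. Qed.

End ConeAlgebra.

(** * Perfect pseudo MV-algebras as algebras K(L, lambda) *)

Section Negations.
Variable A : flw.
Implicit Types x y z : A.

Definition lneg x : A := ldiv x zero.
Definition rneg x : A := rdiv zero x.

Lemma ldiv_rdiv x y z : ldiv x (rdiv z y) = rdiv (ldiv x z) y.
Proof.
by apply: le_ext => t; rewrite ldiv_residual !rdiv_residual ldiv_residual mul_assoc.
Qed.

Lemma ldiv_mul x y z : ldiv (mul x y) z = ldiv y (ldiv x z).
Proof. by apply: le_ext => t; rewrite !ldiv_residual mul_assoc. Qed.

Lemma rdiv_mul x y z : rdiv z (mul x y) = rdiv (rdiv z y) x.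
Proof. by apply: le_ext => t; rewrite !rdiv_residual mul_assoc. Qed.

Lemma le_lneg_rneg x y : le x (lneg y) <-> le y (rneg x).
Proof. by rewrite ldiv_residual rdiv_residual. Qed.

Hypothesis Amv : pseudo_mv A.

Lemma lnegK x : rneg (lneg x) = x.
Proof. by rewrite /rneg /lneg; have [-> _] := Amv zero x; rewrite joinC join_zero. Qed.

Lemma rnegK x : lneg (rneg x) = x.
Proof. by rewrite /rneg /lneg; have [_ <-] := Amv zero x; rewrite joinC join_zero. Qed.

Lemma le_lneg x y : le (lneg y) (lneg x) <-> le x y.
Proof. by rewrite le_lneg_rneg lnegK. Qed.

Lemma le_rneg x y : le (rneg y) (rneg x) <-> le x y.
Proof. by rewrite -le_lneg_rneg rnegK. Qed.

Lemma lneg_meet x y : lneg (meet x y) = join (lneg x) (lneg y).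
Proof.
apply: le_anti.
  by rewrite -le_rneg lnegK; apply/le_meet; split; rewrite -[X in le _ X]lnegK le_rneg;
    [apply: join_gel|apply: join_ger].
by apply/join_le; rewrite !le_lneg; split; [apply: meet_lel|apply: meet_ler].
Qed.

Lemma rneg_meet x y : rneg (meet x y) = join (rneg x) (rneg y).
Proof.
apply: le_anti.
  by rewrite -le_lneg rnegK; apply/le_meet; split; rewrite -[X in le _ X]rnegK le_lneg;
    [apply: join_gel|apply: join_ger].
by apply/join_le; rewrite !le_rneg; split; [apply: meet_lel|apply: meet_ler].
Qed.

(** Divisibility is the De Morgan dual of the identities for the join. *)
Lemma mul_ldiv x y : mul x (ldiv x y) = meet x y.
Proof.
rewrite -[RHS]lnegK lneg_meet; have [_ ->] := Amv (lneg x) (lneg y).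
by rewrite -ldiv_rdiv -/(rneg _) lnegK -ldiv_mul -/(lneg _) lnegK.
Qed.

Lemma rdiv_mulr x y : mul (rdiv y x) x = meet x y.
Proof.
rewrite -[RHS]rnegK rneg_meet; have [<- _] := Amv (rneg x) (rneg y).
by rewrite ldiv_rdiv -/(lneg _) rnegK -rdiv_mul -/(rneg _) rnegK.
Qed.

Lemma lneg_mul x y : lneg (mul x y) = ldiv y (lneg x). Proof. exact: ldiv_mul. Qed.

Lemma rneg_mul x y : rneg (mul x y) = rdiv (rneg y) x. Proof. exact: rdiv_mul. Qed.

Lemma ldiv_mulK x y : le (lneg x) y -> ldiv x (mul x y) = y.
Proof.
move=> xy; rewrite -[mul x y]rnegK rneg_mul -ldiv_mul rdiv_mulr meetC.
have -> : le (rneg y) x by rewrite -le_lneg rnegK.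
exact: rnegK.
Qed.

Lemma rdiv_mulK x y : le (rneg x) y -> rdiv (mul y x) x = y.
Proof.
move=> xy; rewrite -[mul y x]lnegK lneg_mul -rdiv_mul mul_ldiv meetC.
have -> : le (lneg y) x by rewrite -le_rneg lnegK.
exact: lnegK.
Qed.

Lemma lneg_lnegM : {morph (fun x => lneg (lneg x)) : x y / mul x y}.
Proof.
move=> x y; rewrite -[RHS]rnegK rneg_mul !lnegK; congr lneg; rewrite lneg_mul.
by rewrite -[lneg x in LHS]lnegK ldiv_rdiv.
Qed.

End Negations.

Section Representation.
Variables (A : flw) (Amv : pseudo_mv A) (h : A -> two).
Hypotheses (hh : homomorphism h) (hle : forall x y, h x = zero -> h y = one -> le x y).
Implicit Types x y z : A.

Let hm x y : h (meet x y) = h x && h y :> bool. Proof. by have [->] := hh. Qed.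
Let hj x y : h (join x y) = h x || h y :> bool. Proof. by have [_ ->] := hh. Qed.
Let hM x y : h (mul x y) = h x && h y :> bool. Proof. by have [_ _ ->] := hh. Qed.
Let hl x y : h (ldiv x y) = (h x ==> h y) :> bool. Proof. by have [_ _ _ ->] := hh. Qed.
Let hr x y : h (rdiv y x) = (h x ==> h y) :> bool. Proof. by have [_ _ _ _ [->]] := hh. Qed.
Let h0 : h zero = false. Proof. by have [_ _ _ _ [_ ->]] := hh. Qed.
Let h1 : h one = true. Proof. by have [_ _ _ _ [_ _ ->]] := hh. Qed.
Let h_lneg x : h (lneg x) = ~~ h x :> bool. Proof. by rewrite hl h0 implybF. Qed.
Let h_rneg x : h (rneg x) = ~~ h x :> bool. Proof. by rewrite hr h0 implybF. Qed.

Definition upper := {x : A | h x = true}.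
Implicit Types a b c : upper.

Lemma upper_eq a b : sval a = sval b -> a = b.
Proof. by case: a b => [x px] [y py] /= e; apply: eq_exist. Qed.

Definition upper_op (f : A -> A -> A) (fP : forall x y, h x = true -> h y = true ->
  h (f x y) = true) a b : upper := exist _ (f (sval a) (sval b)) (fP _ _ (proj2_sig a) (proj2_sig b)).

Let um x y : h x = true -> h y = true -> h (meet x y) = true.
Proof. by move=> hx hy; rewrite hm hx hy. Qed.
Let uj x y : h x = true -> h y = true -> h (join x y) = true.
Proof. by move=> hx hy; rewrite hj hx hy. Qed.
Let uM x y : h x = true -> h y = true -> h (mul x y) = true.
Proof. by move=> hx hy; rewrite hM hx hy. Qed.

Definition upper_meet := upper_op um.
Definition upper_join := upper_op uj.
Definition upper_mul := upper_op uM.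
Definition upper_one : upper := exist _ one h1.

Lemma upper_meetC : commutative upper_meet.
Proof. by move=> a b; apply/upper_eq/meetC. Qed.
Lemma upper_joinC : commutative upper_join.
Proof. by move=> a b; apply/upper_eq/joinC. Qed.
Lemma upper_meetA : associative upper_meet.
Proof. by move=> a b c; apply/upper_eq/meetA. Qed.
Lemma upper_joinA : associative upper_join.
Proof. by move=> a b c; apply/upper_eq/joinA. Qed.
Lemma upper_meet_joinK a b : upper_meet a (upper_join a b) = a.
Proof. exact/upper_eq/meet_joinK. Qed.
Lemma upper_join_meetK a b : upper_join a (upper_meet a b) = a.
Proof. exact/upper_eq/join_meetK. Qed.

Definition upper_lattice : lattice :=
  Lattice upper_meetC upper_joinC upper_meetA upper_joinA upper_meet_joinK upper_join_meetK.

Lemma upper_leE (a b : upper_lattice) : le a b <-> le (sval a) (sval b).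
Proof. by split=> [/(congr1 sval)|e]; [|apply: upper_eq]. Qed.

Let le_lower x y : h x = false -> h y = true -> le x y. Proof. exact: hle. Qed.

Lemma upper_mulA : associative upper_mul.
Proof. by move=> a b c; apply/upper_eq/mul_assoc. Qed.
Lemma upper_mul1 : left_id upper_one upper_mul.
Proof. by move=> a; apply/upper_eq/mul_onel. Qed.
Lemma upper_mulr1 : right_id upper_one upper_mul.
Proof. by move=> a; apply/upper_eq/mul_oner. Qed.

Lemma upper_mulI a : injective (upper_mul a).
Proof.
have K b : ldiv (sval a) (sval (upper_mul a b)) = sval b.
  by apply: ldiv_mulK => //; apply: le_lower (proj2_sig b); rewrite h_lneg (proj2_sig a).
by move=> b c e; apply: upper_eq; rewrite -K e K.
Qed.

Lemma upper_mulIr a b c : upper_mul b a = upper_mul c a -> b = c.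
Proof.
have K d : rdiv (sval (upper_mul d a)) (sval a) = sval d.
  by apply: rdiv_mulK => //; apply: le_lower (proj2_sig d); rewrite h_rneg (proj2_sig a).
by move=> e; apply: upper_eq; rewrite -K e K.
Qed.

Lemma upper_le_l (a b : upper_lattice) : le a b <-> exists c, a = upper_mul b c.
Proof.
rewrite upper_leE; split=> [ab|[c ->]]; last first.
  by rewrite -[X in le _ X]mul_oner; apply/mul_le2l/le_one.
have uP : h (ldiv (sval b) (sval a)) = true by rewrite hl (proj2_sig a) implybT.
by exists (exist (fun x => h x = true) _ uP); apply: upper_eq; rewrite /= mul_ldiv // meetC.
Qed.

Lemma upper_le_r (a b : upper_lattice) : le a b <-> exists c, a = upper_mul c b.
Proof.
rewrite upper_leE; split=> [ab|[c ->]]; last first.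
  by rewrite -[X in le _ X]mul_onel; apply/mul_le2r/le_one.
have uP : h (rdiv (sval a) (sval b)) = true by rewrite hr (proj2_sig a) implybT.
by exists (exist (fun x => h x = true) _ uP); apply: upper_eq; rewrite /= rdiv_mulr // meetC.
Qed.

Definition upper_cone : cone := @Cone upper_lattice upper_mul upper_one
  upper_mulA upper_mul1 upper_mulr1 upper_mulI upper_mulIr upper_le_l upper_le_r.

Let h_lneg2 a : h (lneg (lneg (sval a))) = true.
Proof. by rewrite !h_lneg negbK (proj2_sig a). Qed.
Let h_rneg2 a : h (rneg (rneg (sval a))) = true.
Proof. by rewrite !h_rneg negbK (proj2_sig a). Qed.

(** In K(L, lambda) the double left negation of an element of the negative cone is
    its image under lambda. *)
Definition upper_aut a : upper := exist _ _ (h_lneg2 a).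
Definition upper_aut_inv a : upper := exist _ _ (h_rneg2 a).

Lemma upper_autK : cancel upper_aut upper_aut_inv.
Proof. by move=> a; apply: upper_eq; rewrite /= !lnegK. Qed.
Lemma upper_aut_invK : cancel upper_aut_inv upper_aut.
Proof. by move=> a; apply: upper_eq; rewrite /= !rnegK. Qed.
Lemma upper_autM : {morph upper_aut : a b / @cmul upper_cone a b}.
Proof. by move=> a b; apply/upper_eq/lneg_lnegM. Qed.

Definition rep_lgroup : lgroup := frac_lgroup upper_cone.
Definition rep_aut : lgroup_aut rep_lgroup :=
  @frac_aut upper_cone _ _ upper_autK upper_aut_invK upper_autM.

(** Total on A, so that no proof that x is in the upper part occurs in terms. *)
Definition to_upper x : upper_cone :=
  if pselect (h x = true) is left hx then exist _ x hx else upper_one.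

Lemma to_upperK x : h x = true -> sval (to_upper x) = x.
Proof. by rewrite /to_upper; case: pselect. Qed.

Definition gval x : rep_lgroup := to_frac (to_upper x).

Lemma gval_le1 x : le (gval x) gone. Proof. exact: to_frac_le1. Qed.

Lemma gval_le x y : h x = true -> h y = true -> le (gval x) (gval y) <-> le x y.
Proof. by move=> hx hy; rewrite to_frac_le upper_leE !to_upperK. Qed.

Lemma gval_mul x y : h x = true -> h y = true -> gval (mul x y) = gmul (gval x) (gval y).
Proof.
move=> hx hy; rewrite /gval -to_fracM; congr to_frac.
by apply: upper_eq; rewrite /= !to_upperK // hM hx hy.
Qed.

Lemma gval_one : gval one = gone.
Proof.
rewrite -to_frac1 /gval; congr to_frac.
by apply: upper_eq; rewrite to_upperK.
Qed.

Lemma gval_aut x : h x = true -> rep_aut (gval x) = gval (lneg (lneg x)).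
Proof.
move=> hx; rewrite /gval frac_aut_of; congr to_frac.
by apply: upper_eq; rewrite /= !to_upperK // !h_lneg hx.
Qed.

Lemma gval_surj g : le g gone -> exists2 x, h x = true & g = gval x.
Proof.
move=> /to_frac_surj[a ->]; exists (sval a); first exact: proj2_sig a.
by congr to_frac; apply: upper_eq; rewrite to_upperK //; apply: proj2_sig a.
Qed.

Lemma gval_ldiv x y : h x = true -> h y = true ->
  gval (ldiv x y) = meet (gmul (ginv (gval x)) (gval y)) gone.
Proof.
move=> hx hy; apply: le_ext => g; rewrite le_meet.
have hxy : h (ldiv x y) = true by rewrite hl hx hy.
split=> [gxy|[gxy /gval_surj[z hz zE]]].
  have g1 := le_trans gxy (gval_le1 _); have [z hz zE] := gval_surj g1.
  split=> //; move: gxy; rewrite zE gval_le // -gmul_leL -gval_mul //.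
  by rewrite ldiv_residual gval_le // hM hx hz.
move: gxy; rewrite zE gval_le // -gmul_leL -gval_mul //.
by rewrite ldiv_residual gval_le // hM hx hz.
Qed.

Lemma gval_rdiv x y : h x = true -> h y = true ->
  gval (rdiv y x) = meet (gmul (gval y) (ginv (gval x))) gone.
Proof.
move=> hx hy; apply: le_ext => g; rewrite le_meet.
have hxy : h (rdiv y x) = true by rewrite hr hx hy.
split=> [gxy|[gxy /gval_surj[z hz zE]]].
  have g1 := le_trans gxy (gval_le1 _); have [z hz zE] := gval_surj g1.
  split=> //; move: gxy; rewrite zE gval_le // -gmul_leR -gval_mul //.
  by rewrite rdiv_residual gval_le // hM hx hz.
move: gxy; rewrite zE gval_le // -gmul_leR -gval_mul //.
by rewrite rdiv_residual gval_le // hM hx hz.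
Qed.

(** In K(L, lambda) the left negation of an element y of the positive cone is y^-1;
    this determines the image of an element of the lower part. *)
Definition rep x : cone_flw rep_aut :=
  if h x : bool then meet_neg (gval x) else join_pos (ginv (gval (lneg x))).

Let ginv_gval_ge1 x : le gone (ginv (gval x)).
Proof. by rewrite -{1}ginv1 ginv_le; apply: gval_le1. Qed.

Lemma rep_surj k : exists x, rep x = k.
Proof.
case: k / (coneP k) => g g1.
  by have [x hx ->] := gval_surj g1; exists x; rewrite /rep hx.
have [|x hx gE] := @gval_surj (ginv g); first by rewrite -ginv_le ginvK ginv1.
by exists (rneg x); rewrite /rep h_rneg hx rnegK // -gE ginvK.
Qed.

Lemma rep_neg x : h x = true -> rep x = meet_neg (gval x).
Proof. by rewrite /rep => ->. Qed.

Lemma rep_pos x : h x = false -> rep x = join_pos (ginv (gval (lneg x))).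
Proof. by rewrite /rep => ->. Qed.

Lemma rep_le x y : le x y <-> le (rep x) (rep y).
Proof.
case hx: (h x : bool); case hy: (h y : bool).
- by rewrite (rep_neg hx) (rep_neg hy) (le_neg_neg _ (gval_le1 x) (gval_le1 y)) gval_le.
- rewrite (rep_neg hx) (rep_pos hy).
  by split=> [xy|/le_neg_pos //]; have := hm x y; rewrite xy hx hy.
- by rewrite (rep_pos hx) (rep_neg hy); split=> _; [apply: le_pos_neg|apply: hle].
- rewrite (rep_pos hx) (rep_pos hy).
  rewrite (le_pos_pos _ (ginv_gval_ge1 _) (ginv_gval_ge1 _)) ginv_le.
  by rewrite gval_le ?le_lneg ?h_lneg ?hx ?hy.
Qed.

Lemma repM : {morph rep : x y / mul x y}.
Proof.
move=> x y; have := hM x y; case hx: (h x : bool); case hy: (h y : bool) => hxy.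
- rewrite (rep_neg hx) (rep_neg hy) (rep_neg hxy) gval_mul //.
  by rewrite (mul_neg_neg _ (gval_le1 x) (gval_le1 y)).
- have hny : h (lneg y) = true by rewrite h_lneg hy.
  have hnx : h (lneg (lneg x)) = true by rewrite !h_lneg hx.
  rewrite (rep_neg hx) (rep_pos hy) (rep_pos hxy).
  have -> : lneg (mul x y) = rdiv (lneg y) (lneg (lneg x)).
    by rewrite -[LHS]lnegK // lneg_lnegM // rneg_mul lnegK.
  rewrite (mul_neg_pos _ (gval_le1 x) (ginv_gval_ge1 _)).
  by rewrite gval_rdiv // ginv_meet ginv1 ginvM ginvK gval_aut // join_posK.
- have hnx : h (lneg x) = true by rewrite h_lneg hx.
  rewrite (rep_pos hx) (rep_neg hy) (rep_pos hxy).
  rewrite (mul_pos_neg _ (ginv_gval_ge1 _) (gval_le1 y)).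
  by rewrite lneg_mul gval_ldiv // ginv_meet ginv1 ginvM ginvK join_posK.
- rewrite (rep_pos hx) (rep_pos hy) (rep_pos hxy).
  have -> : mul x y = zero.
    by apply: le_anti (zero_le _); apply/ldiv_residual/le_lower; rewrite ?h_lneg ?hx.
  have -> : lneg zero = one :> A by apply/ldiv_eq1/le_refl.
  by rewrite gval_one ginv1 -zero_pos.
Qed.

End Representation.

Lemma perfect_representation (A : flw) : pseudo_mv A -> perfect A ->
  exists (L : lgroup) (lam : lgroup_aut L) (r : A -> cone_flw lam),
    [/\ homomorphism r, injective r & forall c, exists x, r x = c].
Proof.
move=> Amv [h [hh hle]]; exists _, (rep_aut Amv hh hle), (rep Amv hh hle); split.
- by apply: order_iso_hom; [apply: rep_surj|apply: rep_le|apply: repM].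
- by move=> x y e; apply: le_anti; apply/(rep_le Amv hh hle); rewrite e; apply: le_refl.
- exact: rep_surj.
Qed.

(** * Embedding K(L, lambda) into a kite *)

Section ConePerfect.
Variables (L : lgroup) (lam : lgroup_aut L).
Implicit Types x y : L.

Lemma aut_ginv x : lam (ginv x) = ginv (lam x).
Proof. by apply: ginv_uniq; rewrite -autM gmul_invr aut1. Qed.

Lemma aut_invM : {morph aut_inv lam : x y / gmul x y}.
Proof. by move=> x y; apply: (can_inj (autK lam)); rewrite autM !aut_invK. Qed.

Lemma aut_inv_meet : {morph aut_inv lam : x y / meet x y}.
Proof. by move=> x y; apply: (can_inj (autK lam)); rewrite aut_meet !aut_invK. Qed.

Lemma aut_inv_join : {morph aut_inv lam : x y / join x y}.
Proof. by move=> x y; apply: (can_inj (autK lam)); rewrite aut_join !aut_invK. Qed.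

Lemma aut_inv1 : aut_inv lam gone = gone.
Proof. by apply: (can_inj (autK lam)); rewrite aut_invK aut1. Qed.

Lemma aut_inv_ginv x : aut_inv lam (ginv x) = ginv (aut_inv lam x).
Proof. by apply: ginv_uniq; rewrite -aut_invM gmul_invr aut_inv1. Qed.

Lemma cone_perfect : perfect (cone_flw lam).
Proof.
exists (fun c => if c is inl _ then true else false : two); split.
  by split; last split; do ?[move=> [x|x] [y|y]].
by move=> [x|x] [y|y] //= _ _; apply/cone_leE.
Qed.

Lemma cone_pseudo_mv : pseudo_mv (cone_flw lam).
Proof.
have dl x y : gmul x (ginv (meet (gmul (ginv y) x) gone)) = join x y.
  by rewrite ginv_meet ginv1 ginvM ginvK gmul_join gmulKV gmul_oner joinC.
have dr x y : gmul (ginv (meet (gmul x (ginv y)) gone)) x = join x y.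
  by rewrite ginv_meet ginv1 ginvM ginvK join_gmul gmulVK gmul_onel joinC.
have j1 x y : le x gone -> le y gone -> le (join x y) gone.
  by move=> x1 y1; apply/join_le.
move=> [[x x1]|[x x1]] [[y y1]|[y y1]]; split;
  first [apply: inl_eq|apply: inr_eq] => /=.
- by rewrite dl; apply: j1.
- by rewrite dr; apply/esym/j1.
- by rewrite ginv1 gmul_oner.
- by rewrite ginv1 gmul_onel; apply/esym.
- by rewrite ginvM ginvK gmulKV autK.
- by rewrite ginvM ginvK gmulVK; apply/esym.
- exact: dl.
- by rewrite aut_meet aut_invK aut1 dr.
Qed.

End ConePerfect.

Section ConeMap.
Variables (L M : lgroup) (lam : lgroup_aut L) (mu : lgroup_aut M) (f : L -> M).
Hypotheses (fM : {morph f : x y / gmul x y}) (fm : {morph f : x y / meet x y})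
  (fj : {morph f : x y / join x y}) (flam : forall x, f (lam x) = mu (f x)).

Let f1 : f gone = gone.
Proof. by rewrite -(gmulI (f gone) (f gone)) -fM gmul_onel gmul_invl. Qed.
Let fV x : f (ginv x) = ginv (f x).
Proof. by apply: ginv_uniq; rewrite -fM gmul_invr. Qed.
Let flami x : f (aut_inv lam x) = aut_inv mu (f x).
Proof. by apply: (can_inj (autK mu)); rewrite -flam !aut_invK. Qed.
Let fle x y : le x y -> le (f x) (f y). Proof. by rewrite /le -fm => ->. Qed.
Let fneg (x : neg_cone L) : le (f (sval x)) gone.
Proof. by rewrite -f1; apply/fle/(proj2_sig x). Qed.
Let fpos (x : pos_cone L) : le gone (f (sval x)).
Proof. by rewrite -f1; apply/fle/(proj2_sig x). Qed.

Definition cone_map (c : cone_flw lam) : cone_flw mu :=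
  match c with inl x => in_neg (fneg x) | inr x => in_pos (fpos x) end.

Lemma cone_map_hom : homomorphism cone_map.
Proof.
by split; last split; do ?[move=> [x|x] [y|y]] => //=;
  first [apply: inl_eq|apply: inr_eq]; rewrite /= ?(fM, fm, fj, fV, flam, flami, f1).
Qed.

Lemma cone_map_inj : injective f -> injective cone_map.
Proof.
by move=> fi [x|x] [y|y] // [/fi e]; [apply: inl_eq|apply: inr_eq].
Qed.

End ConeMap.

(** The endomorphisms of L that commute with lambda form a B-cycle, with composition
    with lambda as beta. Evaluation embeds K(L, lambda) into the kite over this B-cycle, and
    beta^m is the identity as soon as lambda^m is. *)
Section Endomorphisms.
Variables (L : lgroup) (lam : lgroup_aut L).

Record is_end (f : L -> L) : Prop := IsEnd {
  endM : {morph f : x y / gmul x y};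
  end_meet : {morph f : x y / meet x y};
  end_join : {morph f : x y / join x y};
  end_lam : forall x, f (lam x) = lam (f x) }.

Definition endo := {f : L -> L | is_end f}.

Lemma endo_eq (f g : endo) : (forall x, sval f x = sval g x) -> f = g.
Proof. by case: f g => [f fe] [g ge] /= /funext e; apply: eq_exist. Qed.

Lemma is_end_lam (f : endo) : is_end (fun x => lam (sval f x)).
Proof.
case: f => f [fM fm fj fl] /=.
by split=> x *; rewrite ?(fM, fm, fj, fl) ?(autM, aut_meet, aut_join).
Qed.

Lemma is_end_lami (f : endo) : is_end (fun x => aut_inv lam (sval f x)).
Proof.
case: f => f [fM fm fj fl] /=.
split=> x *; rewrite ?(fM, fm, fj, fl) ?(aut_invM, aut_inv_meet, aut_inv_join) //.
by rewrite autK aut_invK.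
Qed.

Definition endo_beta (f : endo) : endo := exist _ _ (is_end_lam f).
Definition endo_beta_inv (f : endo) : endo := exist _ _ (is_end_lami f).

Lemma endo_betaK : cancel endo_beta endo_beta_inv.
Proof. by move=> f; apply: endo_eq => x /=; rewrite autK. Qed.
Lemma endo_beta_invK : cancel endo_beta_inv endo_beta.
Proof. by move=> f; apply: endo_eq => x /=; rewrite aut_invK. Qed.

Definition endo_cycle : bcycle := BCycle endo_betaK endo_beta_invK.

Lemma iter_endo_beta k (f : endo_cycle) x :
  sval (iter k (@beta endo_cycle) f) x = iter k lam (sval f x).
Proof. by elim: k => //= k ->. Qed.

Lemma is_end_id : is_end id. Proof. by []. Qed.

Lemma cone_in_kite : exists h : cone_flw lam -> kite L endo_cycle,
  homomorphism h /\ injective h.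
Proof.
pose ev (x : L) : pow_lgroup L endo_cycle := fun f : endo => sval f x.
have evM : {morph ev : x y / gmul x y}.
  by move=> x y; apply/funext => f; apply: endM (proj2_sig f) _ _.
have evm : {morph ev : x y / meet x y}.
  by move=> x y; apply/funext => f; apply: end_meet (proj2_sig f) _ _.
have evj : {morph ev : x y / join x y}.
  by move=> x y; apply/funext => f; apply: end_join (proj2_sig f) _ _.
have evl x : ev (lam x) = shift_aut L endo_cycle (ev x).
  by apply/funext => f; apply: end_lam (proj2_sig f) _.
exists (cone_map (shift_aut L endo_cycle) evM evm); split; first exact: cone_map_hom.
apply: cone_map_inj => x y /(congr1 (fun g : endo -> L => g (exist _ id is_end_id))).
by [].
Qed.

End Endomorphisms.

(** * Terms of lattice-ordered groups with an automorphism *)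

Inductive gterm (X : Type) : Type :=
  | GVar of X
  | GOne
  | GInv of gterm X
  | GMul of gterm X & gterm X
  | GMeet of gterm X & gterm X
  | GJoin of gterm X & gterm X
  | GLam of gterm X
  | GLami of gterm X.

Arguments GOne {X}.

Fixpoint geval (L : lgroup) (lam : lgroup_aut L) X (v : X -> L) (t : gterm X) : L :=
  match t with
  | GVar x => v x
  | GOne => gone
  | GInv t => ginv (geval lam v t)
  | GMul s t => gmul (geval lam v s) (geval lam v t)
  | GMeet s t => meet (geval lam v s) (geval lam v t)
  | GJoin s t => join (geval lam v s) (geval lam v t)
  | GLam t => lam (geval lam v t)
  | GLami t => aut_inv lam (geval lam v t)
  end.

(** An element of K(L, lambda) as a sign, true on the negative cone, and a value. *)
Definition signed (L : lgroup) (c : cone_sort L) : bool * L :=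
  match c with inl x => (true, sval x) | inr x => (false, sval x) end.

Lemma signed_inj L : injective (@signed L).
Proof. by move=> [x|x] [y|y] // [e]; [apply: inl_eq|apply: inr_eq]. Qed.

(** The value of a term in K(L, lambda), for a given choice of the signs of the
    variables, is a term in the values of the variables. *)
Fixpoint symbolic (sg : nat -> bool) (t : term) : bool * gterm nat :=
  match t with
  | Var n => (sg n, if sg n then GMeet (GVar n) GOne else GJoin (GVar n) GOne)
  | Zero => (false, GOne)
  | One => (true, GOne)
  | Meet s t =>
    match symbolic sg s, symbolic sg t with
    | (true, x), (true, y) => (true, GMeet x y)
    | (true, _), (false, y) => (false, y)
    | (false, x), (true, _) => (false, x)
    | (false, x), (false, y) => (false, GMeet x y)
    end
  | Join s t =>
    match symbolic sg s, symbolic sg t with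
    | (true, x), (true, y) => (true, GJoin x y)
    | (true, x), (false, _) => (true, x)
    | (false, _), (true, y) => (true, y)
    | (false, x), (false, y) => (false, GJoin x y)
    end
  | Mul s t =>
    match symbolic sg s, symbolic sg t with
    | (true, x), (true, y) => (true, GMul x y)
    | (true, x), (false, y) => (false, GJoin (GMul (GLam x) y) GOne)
    | (false, x), (true, y) => (false, GJoin (GMul x y) GOne)
    | (false, _), (false, _) => (false, GOne)
    end
  | Ldiv s t =>
    match symbolic sg s, symbolic sg t with
    | (true, x), (true, z) => (true, GMeet (GMul (GInv x) z) GOne)
    | (true, x), (false, z) => (false, GMul (GInv (GLam x)) z)
    | (false, _), (true, _) => (true, GOne)
    | (false, x), (false, z) => (true, GMeet (GMul (GInv x) z) GOne)
    end
  | Rdiv s t =>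
    match symbolic sg t, symbolic sg s with
    | (true, y), (true, z) => (true, GMeet (GMul z (GInv y)) GOne)
    | (true, y), (false, z) => (false, GMul z (GInv y))
    | (false, _), (true, _) => (true, GOne)
    | (false, y), (false, z) => (true, GMeet (GLami (GMul z (GInv y))) GOne)
    end
  end.

Section Symbolic.
Variables (L : lgroup) (lam : lgroup_aut L).

Definition with_sign (b : bool) (x : L) : cone_flw lam :=
  if b then meet_neg x else join_pos x.

Lemma symbolicP (sg : nat -> bool) (v : nat -> L) t :
  signed (eval (fun n => with_sign (sg n) (v n)) t) =
  ((symbolic sg t).1, geval lam v (symbolic sg t).2).
Proof.
have bin (s s' : term) (P : Prop) :
    (forall b b' w w' c c', symbolic sg s = (b, w) -> symbolic sg s' = (b', w') ->
      signed c = (b, geval lam v w) -> signed c' = (b', geval lam v w') ->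
      eval (fun n => with_sign (sg n) (v n)) s = c ->
      eval (fun n => with_sign (sg n) (v n)) s' = c' -> P) ->
    signed (eval (fun n => with_sign (sg n) (v n)) s) =
      ((symbolic sg s).1, geval lam v (symbolic sg s).2) ->
    signed (eval (fun n => with_sign (sg n) (v n)) s') =
      ((symbolic sg s').1, geval lam v (symbolic sg s').2) -> P.
  case es: (symbolic sg s) => [b w]; case es': (symbolic sg s') => [b' w'] h /= hs hs'.
  by apply: (h b b' w w' _ _ _ _ hs hs').
elim: t => //= [n|||||]; first by rewrite /with_sign; case: (sg n).
all: move=> s IHs s' IHs'; move: IHs IHs'; apply: bin.
all: move=> [] [] w w' [x|x] [y|y] -> -> //= [ex] [ey] -> -> /=; by rewrite ?ex ?ey.
Qed.

Lemma with_sign_surj (c : cone_flw lam) : c = with_sign (signed c).1 (signed c).2.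
Proof.
case: c => [[x x1]|[x x1]]; rewrite /with_sign /=; first by apply: inl_eq; rewrite /= x1.
by apply: inr_eq; rewrite /= joinC; apply/esym/le_joinE.
Qed.

Lemma satisfies_symbolic s t (sg : nat -> bool) (v : nat -> L) :
    satisfies (cone_flw lam) (s, t) ->
  (symbolic sg s).1 = (symbolic sg t).1 /\
  geval lam v (symbolic sg s).2 = geval lam v (symbolic sg t).2.
Proof.
move=> st; have := symbolicP sg v s; rewrite st symbolicP => -[-> ->].
by [].
Qed.

Lemma symbolic_satisfies s t :
    (forall sg v, (symbolic sg s).1 = (symbolic sg t).1 /\
      geval lam v (symbolic sg s).2 = geval lam v (symbolic sg t).2) ->
  satisfies (cone_flw lam) (s, t).
Proof.
move=> st v; apply: signed_inj => /=.
have -> : v = fun n => with_sign (signed (v n)).1 (signed (v n)).2.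
  by apply/funext => n; apply: with_sign_surj.
by rewrite !symbolicP; have [-> ->] := st (fun n => (signed (v n)).1) (fun n => (signed (v n)).2).
Qed.

End Symbolic.

(** Conversely, every term of groups is a fraction of two terms that take values in
    the negative cone. The residuals of the cone give common denominators, since
    b (b \ d) = d (d \ b), and they let one rewrite b^-1 c as (b \ c) (c \ b)^-1. *)
Fixpoint fraction X (r : X -> term * term) (w : gterm X) : term * term :=
  match w with
  | GVar x => r x
  | GOne => (One, One)
  | GInv w => let: (s, t) := fraction r w in (t, s)
  | GMul w w' =>
    let: (s, t) := fraction r w in let: (s', t') := fraction r w' in
    (Mul s (Ldiv t s'), Mul t' (Ldiv s' t))
  | GMeet w w' =>
    let: (s, t) := fraction r w in let: (s', t') := fraction r w' in
    (Meet (Mul s (Ldiv t t')) (Mul s' (Ldiv t' t)), Mul t (Ldiv t t'))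
  | GJoin w w' =>
    let: (s, t) := fraction r w in let: (s', t') := fraction r w' in
    (Join (Mul s (Ldiv t t')) (Mul s' (Ldiv t' t)), Mul t (Ldiv t t'))
  | GLam w =>
    let: (s, t) := fraction r w in
    (Ldiv (Ldiv s Zero) Zero, Ldiv (Ldiv t Zero) Zero)
  | GLami w =>
    let: (s, t) := fraction r w in
    (Rdiv Zero (Rdiv Zero s), Rdiv Zero (Rdiv Zero t))
  end.

Fixpoint gvars (X : eqType) (w : gterm X) : seq X :=
  match w with
  | GVar x => [:: x]
  | GOne => [::]
  | GInv w | GLam w | GLami w => gvars w
  | GMul w w' | GMeet w w' | GJoin w w' => gvars w ++ gvars w'
  end.

Section Fraction.
Variables (L : lgroup) (lam : lgroup_aut L).

Definition is_fraction (v : nat -> cone_flw lam) (p : term * term) (g : L) : Prop :=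
  exists a b : neg_cone L,
    [/\ eval v p.1 = inl a, eval v p.2 = inl b & g = gmul (sval a) (ginv (sval b))].

Lemma meet_one_cancel (g : L) : meet g gone = gmul g (meet (ginv g) gone).
Proof. by rewrite gmul_meet gmul_invr gmul_oner meetC. Qed.

Lemma fractionP (X : eqType) (r : X -> term * term) (v : nat -> cone_flw lam)
    (nu : X -> L) (w : gterm X) :
    (forall x, x \in gvars w -> is_fraction v (r x) (nu x)) ->
  is_fraction v (fraction r w) (geval lam nu w).
Proof.
have div2 (b c : L) : gmul (ginv b) c = ginv (gmul (ginv c) b) by rewrite ginvM ginvK.
have m (b c : L) : meet (gmul (ginv b) c) gone =
    gmul (ginv b) (gmul c (meet (gmul (ginv c) b) gone)).
  by rewrite {1}meet_one_cancel -div2 -gmul_assoc.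
have cd (b d : L) : gmul b (meet (gmul (ginv b) d) gone) =
    gmul d (meet (gmul (ginv d) b) gone).
  by rewrite m gmulKV.
elim: w => [x|||||||] /=.
- by apply; rewrite inE.
- move=> _; pose e : neg_cone L := exist (fun x => le x gone) gone (le_refl gone).
  exists e, e.
  by split=> //=; rewrite gmul_invr.
- move=> w IH /IH; case: (fraction r w) => s t [a [b [/= sE tE ->]]].
  by exists b, a; split=> //; rewrite ginvM ginvK.
- move=> w IH w' IH' h; have {IH}[|a [b []]] := IH.
    by move=> x xw; apply: h; rewrite mem_cat xw.
  have {IH'}[|c [d []]] := IH'.
    by move=> x xw; apply: h; rewrite mem_cat xw orbT.
  case: (fraction r w) (fraction r w') => [s t] [s' t'] /= s'E t'E -> sE tE ->.
  rewrite /is_fraction /= s'E t'E sE tE; do 2 eexists; split; [by []|by []|rewrite /=].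
  by rewrite m ginvM !gmul_assoc gmulK.
- move=> w IH w' IH' h; have {IH}[|a [b []]] := IH.
    by move=> x xw; apply: h; rewrite mem_cat xw.
  have {IH'}[|c [d []]] := IH'.
    by move=> x xw; apply: h; rewrite mem_cat xw orbT.
  case: (fraction r w) (fraction r w') => [s t] [s' t'] /= s'E t'E -> sE tE ->.
  rewrite /is_fraction /= s'E t'E sE tE; do 2 eexists; split; [by []|by []|rewrite /=].
  rewrite meet_gmul; congr meet; last rewrite cd; by rewrite ginvM !gmul_assoc gmulK.
- move=> w IH w' IH' h; have {IH}[|a [b []]] := IH.
    by move=> x xw; apply: h; rewrite mem_cat xw.
  have {IH'}[|c [d []]] := IH'.
    by move=> x xw; apply: h; rewrite mem_cat xw orbT.
  case: (fraction r w) (fraction r w') => [s t] [s' t'] /= s'E t'E -> sE tE ->.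
  rewrite /is_fraction /= s'E t'E sE tE; do 2 eexists; split; [by []|by []|rewrite /=].
  rewrite join_gmul; congr join; last rewrite cd; by rewrite ginvM !gmul_assoc gmulK.
- move=> w IH /IH; case: (fraction r w) => s t [a [b [/= sE tE ->]]].
  rewrite /is_fraction /= sE tE; do 2 eexists; split; [by []|by []|rewrite /=].
  have l1 (c : neg_cone L) : le (lam (sval c)) gone by apply/aut_le1/(proj2_sig c).
  by rewrite !gmul_oner !ginvK !l1 autM aut_ginv.
- move=> w IH /IH; case: (fraction r w) => s t [a [b [/= sE tE ->]]].
  rewrite /is_fraction /= sE tE; do 2 eexists; split; [by []|by []|rewrite /=].
  have l1 (c : neg_cone L) : le (aut_inv lam (sval c)) gone.
    by rewrite (aut_le lam) aut_invK aut1; apply: proj2_sig c.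
  by rewrite !gmul_onel !ginvK !l1 aut_invM aut_inv_ginv.
Qed.

End Fraction.

(** A fraction is trivial exactly when the equation between its numerator and its
    denominator holds, and equations pass from K to the variety that it generates. The
    variables are the elements of L themselves, so that each element of L is available
    as a constant. *)
Lemma transfer (K : set flw) (L : lgroup) (lam : lgroup_aut L) (w : gterm L) :
    K `<=` kites -> generated K (cone_flw lam) ->
    (forall G B, K (kite G B) -> forall nu : L -> pow_lgroup G B,
      geval (shift_aut G B) nu w = gone) ->
  geval lam id w = gone.
Proof.
move=> Kk KL Kw.
pose vs := @gvars {classic L} w.
pose ix (x : {classic L}) := index x vs.
pose N n := Join (Var n) (Ldiv (Var n) Zero).
pose r (x : {classic L}) := (N (ix x).*2, N (ix x).*2.+1).
have Nneg M (mu : lgroup_aut M) (v : nat -> cone_flw mu) n :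
    exists a : neg_cone M, eval v (N n) = inl a.
  by rewrite /=; case: (v n) => x /=; eexists.
have /generatedP /(_ (fraction r w)) Keq := KL.
pose v n : cone_flw lam :=
  let g := nth gone vs n./2 in meet_neg (if odd n then ginv g else g).
have vP (x : {classic L}) : x \in vs -> is_fraction v (r x) (x : L).
  move=> xvs; rewrite /is_fraction /= /v /= odd_double /= doubleK uphalf_double.
  have -> : nth gone vs (ix x) = x by exact: (@nth_index {classic L} gone x vs xvs).
  do 2 eexists; split; [by []|by []|rewrite /=].
  by rewrite {1}meet_one_cancel gmulK.
have [a [b [sE tE ->]]] := @fractionP L lam {classic L} r v id w vP.
have := Keq _ v; rewrite sE tE => st.
have {st}[->] // : inl a = inl b :> cone_flw lam; last by rewrite gmul_invr.
apply: st => C KC u.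
have [G [B CE]] := Kk _ KC; subst C.
have /choice[nu nuP] (x : {classic L}) : exists g, is_fraction u (r x) g.
  have [c cE] := Nneg _ _ u (ix x).*2; have [d dE] := Nneg _ _ u (ix x).*2.+1.
  by exists (gmul (sval c) (ginv (sval d))), c, d.
have [c [d [cE dE e]]] := @fractionP _ _ {classic L} r u nu w (fun x _ => nuP x).
rewrite cE dE; apply: inl_eq; apply/gmul_inv_eq1; rewrite -e.
exact: Kw.
Qed.

(** * Polars and subdirectly irreducible algebras K(L, lambda) *)

Section Polar.
Variables (L : lgroup) (lam : lgroup_aut L).
Implicit Types (x y z d g : L) (D S : L -> Prop).

Definition conjugate g x : L := gmul (ginv g) (gmul x g).

Record stable S : Prop := Stable {
  stable_lam : forall x, S x -> S (lam x);
  stable_lami : forall x, S x -> S (aut_inv lam x);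
  stable_conj : forall g x, S x -> S (conjugate g x) }.

Record normal_submonoid D : Prop := NormalSubmonoid {
  nsub_stable : stable D;
  nsub_ge1 : forall d, D d -> le gone d;
  nsub1 : D gone;
  nsubM : forall d d', D d -> D d' -> D (gmul d d') }.

Section Below.
Variables (D : L -> Prop) (ND : normal_submonoid D).

(** Inequality modulo the convex normal subgroup generated by D. *)
Definition below x y : Prop := exists2 d, D d & le x (gmul d y).

Lemma below_refl x : below x x.
Proof. by exists gone; [apply: nsub1|rewrite gmul_onel; apply: le_refl]. Qed.

Lemma below_trans y x z : below x y -> below y z -> below x z.
Proof.
move=> [d Dd xy] [d' Dd' yz]; exists (gmul d d'); first exact: nsubM.
by apply: le_trans xy _; rewrite -gmul_assoc; apply: gmul_le2l.
Qed.

Lemma below_gmul x x' y y' : below x x' -> below y y' -> below (gmul x y) (gmul x' y').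
Proof.
move=> [d Dd xx] [d' Dd' yy]; exists (gmul d (conjugate (ginv x') d')).
  by apply: nsubM => //; apply: stable_conj (nsub_stable ND) _ _ Dd'.
have -> : gmul (gmul d (conjugate (ginv x') d')) (gmul x' y') = gmul (gmul d x') (gmul d' y').
  by rewrite /conjugate ginvK -!gmul_assoc gmulI.
by apply: le_trans (gmul_le2r _ xx) (gmul_le2l _ yy).
Qed.

Lemma below_ginv x y : below x y -> below (ginv y) (ginv x).
Proof.
move=> [d Dd xy]; exists (conjugate x d).
  exact: stable_conj (nsub_stable ND) _ _ Dd.
rewrite /conjugate -!gmul_assoc gmul_invr gmul_oner.
by apply/gmul_leL/gmul_leR; rewrite ginvK.
Qed.

Lemma below_le d x y : D d -> le x y -> le x (gmul d y).
Proof.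
move=> Dd xy; apply: le_trans xy _; rewrite -{1}(gmul_onel y).
by apply/gmul_le2r/(nsub_ge1 ND).
Qed.

Lemma below_common x x' y y' : below x x' -> below y y' ->
  exists d, [/\ D d, le x (gmul d x') & le y (gmul d y')].
Proof.
move=> [d Dd xx] [d' Dd' yy]; exists (gmul d d'); split; first exact: nsubM.
  apply: le_trans xx _; rewrite -gmul_assoc; apply: gmul_le2l.
  by apply: below_le => //; apply: le_refl.
by rewrite -gmul_assoc; apply: below_le.
Qed.

Lemma below_meet x x' y y' : below x x' -> below y y' -> below (meet x y) (meet x' y').
Proof.
move=> xx yy; have [d [Dd {}xx {}yy]] := below_common xx yy; exists d => //.
rewrite gmul_meet; apply/le_meet.
by split; [apply: le_trans (meet_lel _ _) xx|apply: le_trans (meet_ler _ _) yy].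
Qed.

Lemma below_join x x' y y' : below x x' -> below y y' -> below (join x y) (join x' y').
Proof.
move=> xx yy; have [d [Dd {}xx {}yy]] := below_common xx yy; exists d => //.
rewrite gmul_join; apply/join_le.
by split; [apply: le_trans xx (join_gel _ _)|apply: le_trans yy (join_ger _ _)].
Qed.

Lemma below_lam x y : below x y -> below (lam x) (lam y).
Proof.
move=> [d Dd xy]; exists (lam d); first exact: stable_lam (nsub_stable ND) _ Dd.
by rewrite -autM -aut_le.
Qed.

Lemma below_lami x y : below x y -> below (aut_inv lam x) (aut_inv lam y).
Proof.
move=> [d Dd xy]; exists (aut_inv lam d); first exact: stable_lami (nsub_stable ND) _ Dd.
by rewrite -aut_invM (aut_le lam) !aut_invK.
Qed.

Definition modulo x y : Prop := below x y /\ below y x.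

Lemma modulo_refl x : modulo x x. Proof. by split; apply: below_refl. Qed.
Lemma modulo_sym x y : modulo x y -> modulo y x. Proof. by case. Qed.
Lemma modulo_trans y x z : modulo x y -> modulo y z -> modulo x z.
Proof. by move=> [xy yx] [yz zy]; split; [apply: below_trans xy yz|apply: below_trans zy yx]. Qed.
Lemma modulo_gmul x x' y y' : modulo x x' -> modulo y y' -> modulo (gmul x y) (gmul x' y').
Proof. by move=> [? ?] [? ?]; split; apply: below_gmul. Qed.
Lemma modulo_meet x x' y y' : modulo x x' -> modulo y y' -> modulo (meet x y) (meet x' y').
Proof. by move=> [? ?] [? ?]; split; apply: below_meet. Qed.
Lemma modulo_join x x' y y' : modulo x x' -> modulo y y' -> modulo (join x y) (join x' y').
Proof. by move=> [? ?] [? ?]; split; apply: below_join. Qed.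
Lemma modulo_ginv x y : modulo x y -> modulo (ginv x) (ginv y).
Proof. by move=> [? ?]; split; apply: below_ginv. Qed.
Lemma modulo_lam x y : modulo x y -> modulo (lam x) (lam y).
Proof. by move=> [? ?]; split; apply: below_lam. Qed.
Lemma modulo_lami x y : modulo x y -> modulo (aut_inv lam x) (aut_inv lam y).
Proof. by move=> [? ?]; split; apply: below_lami. Qed.

Definition cone_modulo (c c' : cone_flw lam) : Prop :=
  match c, c' with
  | inl x, inl y => modulo (sval x) (sval y)
  | inr x, inr y => modulo (sval x) (sval y)
  | _, _ => False
  end.

Lemma cone_modulo_congruence : congruence cone_modulo.
Proof.
split.
- by move=> [x|x]; apply: modulo_refl.
- by move=> [x|x] [y|y] //=; apply: modulo_sym.
- by move=> [x|x] [y|y] [z|z] //=; apply: modulo_trans.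
all: move=> [x|x] [x'|x'] [y|y] [y'|y'] //= xx yy; rewrite /in_neg /in_pos /=.
all: do ?[exact: modulo_refl|assumption|apply: modulo_gmul|apply: modulo_meet|
  apply: modulo_join|apply: modulo_ginv|apply: modulo_lam|apply: modulo_lami].
Qed.

End Below.

Definition polar S y : Prop := le gone y /\ forall x, S x -> meet y x = gone.

Lemma polar_stable S : stable S -> stable (polar S).
Proof.
move=> [Sl Sli Sc]; split.
- move=> y [y1 yS]; split; first by rewrite -(aut1 lam) -aut_le.
  by move=> x /Sli /yS; rewrite -{2}(aut_invK lam x) -aut_meet => ->; rewrite aut1.
- move=> y [y1 yS]; split; first by rewrite (aut_le lam) aut_invK aut1.
  move=> x /Sl /yS e; apply: (can_inj (autK lam)).
  by rewrite aut_meet aut_invK e aut1.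
- move=> g y [y1 yS]; split.
    apply/gmul_leL; rewrite gmul_oner -{1}(gmul_onel g).
    exact: gmul_le2r.
  move=> x /(Sc (ginv g)) /yS; rewrite /conjugate ginvK => e.
  have -> : x = gmul (ginv g) (gmul (gmul g (gmul x (ginv g))) g).
    by rewrite -!gmul_assoc gmul_invl gmul_oner gmulI.
  by rewrite -gmul_meet -meet_gmul e gmul_onel gmul_invl.
Qed.

Lemma polar_normal S : stable S -> (forall x, S x -> le gone x) ->
  normal_submonoid (polar S).
Proof.
move=> Ss S1; split; first exact: polar_stable.
- by move=> d [].
- by split=> [|x /S1 //]; apply: le_refl.
- move=> d d' [d1 dS] [d'1 d'S].
  have dd x : le x (gmul d x) by rewrite -{1}(gmul_onel x); apply: gmul_le2r.
  split=> [|x Sx]; first exact: le_trans d'1 (dd _).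
  apply: le_anti; last by apply/le_meet; split; [apply: le_trans d'1 (dd _)|apply: S1].
  rewrite -(dS _ Sx); apply/le_meet; split; last exact: meet_ler.
  rewrite -{2}(gmul_oner d) -(d'S _ Sx) gmul_meet; apply/le_meet.
  by split; [apply: meet_lel|apply: le_trans (meet_ler _ _) (dd _)].
Qed.

Inductive orb (q : L) : L -> Prop :=
  | Orb0 : orb q q
  | OrbLam x of orb q x : orb q (lam x)
  | OrbLami x of orb q x : orb q (aut_inv lam x)
  | OrbConj g x of orb q x : orb q (conjugate g x).

(** Otherwise z lies in the polar of the orbit of q, and q lies in its double polar.
    Both are normal submonoids, so that they give nontrivial congruences, and these meet
    trivially because the elements of one are orthogonal to those of the other. *)
Lemma monolith_not_orthogonal (a b : cone_flw lam) z q : monolith a b ->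
    le gone z -> le gone q -> z <> gone -> q <> gone ->
  exists2 x, orb q x & meet z x <> gone.
Proof.
move=> [ab mab] z1 q1 zn qn; apply: contrapT => no.
have os : stable (orb q) by split=> *; [apply: OrbLam|apply: OrbLami|apply: OrbConj].
have o1 x : orb q x -> le gone x.
  elim=> // {}x.
  - by move=> _; rewrite -{2}(aut1 lam) -aut_le.
  - by move=> _ x1; rewrite (aut_le lam) aut_invK aut1.
  - move=> y _ y1; apply/gmul_leL; rewrite gmul_oner -{1}(gmul_onel x).
    exact: gmul_le2r.
have N1 := polar_normal os o1.
have N2 := polar_normal (nsub_stable N1) (nsub_ge1 N1).
have Pz : polar (orb q) z.
  by split=> // x qx; apply: contrapT => zx; apply: no; exists x.
have Pq : polar (polar (orb q)) q.
  by split=> // x [_ xq]; rewrite meetC; apply/xq/Orb0.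
have {mab} ntriv D d : normal_submonoid D -> D d -> d <> gone -> cone_modulo D a b.
  move=> ND Dd dn; apply: mab; first exact: cone_modulo_congruence.
  exists (in_pos (nsub_ge1 ND Dd)), zero; split; last by move=> [].
  split; exists d => //=; first by rewrite gmul_oner; apply: le_refl.
  exact/(below_le ND Dd)/(nsub_ge1 ND).
have anti x y : below (polar (orb q)) x y -> below (polar (polar (orb q))) x y -> le x y.
  move=> [d Dd xd] [d' [_ /(_ _ Dd) dd] xd'].
  by rewrite -(gmul_onel y) -dd meet_gmul; apply/le_meet.
apply: ab; move: (ntriv _ _ N1 Pz zn) (ntriv _ _ N2 Pq qn) => {ntriv}.
case: a b => [x|x] [y|y] // [xy yx] [xy' yx']; [apply: inl_eq|apply: inr_eq];
  by apply: le_anti; apply: anti.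
Qed.

End Polar.

(** * Kites over the endomorphisms of an irreducible algebra *)

Section Separation.
Variable L : lgroup.
Implicit Type x : L.

(** A substitute for the absolute value that is evidently at least one, and is one
    only at one. *)
Definition gabs (x : L) : L := gmul (join x gone) (join (ginv x) gone).

Lemma gabs_ge1 x : le gone (gabs x).
Proof.
rewrite -(gmul_onel gone); apply: le_trans (gmul_le2r _ (join_ger x gone)) _.
exact/gmul_le2l/join_ger.
Qed.

Lemma gabs1 : gabs gone = gone.
Proof. by rewrite /gabs ginv1 joinxx gmul_onel. Qed.

Lemma gabs_eq1 x : gabs x = gone -> x = gone.
Proof.
have half y z : le gone z -> gmul (join y gone) z = gone -> le y gone.
  move=> z1 e; apply: le_trans (join_gel y gone) _; rewrite -[X in le _ X]e -{1}(gmul_oner (join y gone)).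
  exact: gmul_le2l.
have half' y z : le gone z -> gmul z (join y gone) = gone -> le y gone.
  move=> z1 e; apply: le_trans (join_gel y gone) _; rewrite -[X in le _ X]e -{1}(gmul_onel (join y gone)).
  exact: gmul_le2r.
move=> e; apply: le_anti; first by apply: half e; apply: join_ger.
by rewrite -ginv_le ginv1; apply: half' e; apply: join_ger.
Qed.

End Separation.

Definition GAbs X (w : gterm X) : gterm X :=
  GMul (GJoin w GOne) (GJoin (GInv w) GOne).

Lemma geval_abs (L : lgroup) (lam : lgroup_aut L) X (v : X -> L) w :
  geval lam v (GAbs w) = gabs (geval lam v w).
Proof. by []. Qed.

Section Key.
Variables (L : lgroup) (lam : lgroup_aut L).

(** The orbit of the value of Q consists of values of terms that are trivial on every set
    of coordinates that is closed under beta and on which Q is trivial. *)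
Lemma orb_gterm (Q : gterm L) x : orb lam (geval lam id Q) x ->
  exists2 X : gterm L, geval lam id X = x &
    forall G B (nu : L -> pow_lgroup G B),
      (forall b, le gone (geval (shift_aut G B) nu Q b)) ->
      (forall b, le gone (geval (shift_aut G B) nu X b)) /\
      forall C : B -> Prop, (forall b, C b -> C (beta b)) ->
        (forall b, C b -> C (beta_inv b)) ->
        (forall b, C b -> geval (shift_aut G B) nu Q b = gone) ->
        forall b, C b -> geval (shift_aut G B) nu X b = gone.
Proof.
elim=> {x} [|x _ [X <- XP]|x _ [X <- XP]|g x _ [X <- XP]].
- by exists Q.
- exists (GLam X) => // G B nu /XP[X1 XC]; split=> [b|C Cb Cbi CQ b bC] /=.
    exact: X1.
  by apply: (XC C) => //; apply: Cb.
- exists (GLami X) => // G B nu /XP[X1 XC]; split=> [b|C Cb Cbi CQ b bC] /=.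
    exact: X1.
  by apply: (XC C) => //; apply: Cbi.
- exists (GMul (GInv (GVar g)) (GMul X (GVar g))) => // G B nu /XP[X1 XC].
  split=> [b|C Cb Cbi CQ b bC] /=; rewrite /pow_mul /pow_inv.
    apply/gmul_leL; rewrite gmul_oner -{1}(gmul_onel (nu g b)).
    by apply: gmul_le2r; apply: X1.
  by rewrite (XC C) // gmul_onel gmul_invl.
Qed.

Lemma geval_iter_lam X (G : lgroup) (mu : lgroup_aut G) (v : X -> G) k w :
  geval mu v (iter k (@GLam X) w) = iter k mu (geval mu v w).
Proof. by elim: k => //= k ->. Qed.

Lemma iter_shift G B (x : pow_lgroup G B) k b :
  iter k (shift_aut G B) x b = x (iter k (@beta B) b).
Proof. by elim: k b => //= k IH b; rewrite /shift IH -iterSr. Qed.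

(** As L is irreducible, two nontrivial elements of L have a nontrivial meet once they
    are made positive and the second is replaced by a suitable element of its orbit; the
    term for this meet is trivial at a coordinate of a kite when one of the two is. This is
    applied to w and, for each m such that lambda^m is not the identity, to
    lambda^m(x) x^-1, which is trivial where beta^m c = c. *)
Lemma separating_term (a b : cone_flw lam) (w : gterm L) M : monolith a b ->
    geval lam id w <> gone ->
  exists2 Z : gterm L, geval lam id Z <> gone &
    forall G B (nu : L -> pow_lgroup G B) c, geval (shift_aut G B) nu Z c <> gone ->
      geval (shift_aut G B) nu w c <> gone /\
      forall m, m <= M -> (forall x, iter m lam x = x) \/ iter m (@beta B) c <> c.
Proof.
move=> mab wn; elim: M => [|M [Z Zn ZP]].
  exists w => // G B nu c wc; split=> // m; rewrite leqn0 => /eqP ->.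
  by left.
case: (pselect (forall x, iter M.+1 lam x = x)) => [lam1|].
  exists Z => // G B nu c /ZP[wc mc]; split=> // m; rewrite leq_eqVlt => /orP[/eqP ->|].
    by left.
  exact: mc.
move=> /existsNP[x xn].
pose q := GMul (iter M.+1 (@GLam L) (GVar x)) (GInv (GVar x)); pose Q := GAbs q.
have Qn : geval lam id Q <> gone.
  by rewrite geval_abs => /gabs_eq1; rewrite /= geval_iter_lam => /gmul_inv_eq1.
have [||y] := monolith_not_orthogonal mab (gabs_ge1 (geval lam id Z)) _ _ Qn.
- exact: gabs_ge1.
- by move/gabs_eq1.
move=> /orb_gterm[X <- XP] Xn.
exists (GMeet (GAbs Z) X) => // G B nu c.
have [X1 XC] : (forall b, le gone (geval (shift_aut G B) nu X b)) /\ _ := XP G B nu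
  (fun b => gabs_ge1 (geval (shift_aut G B) nu q b)).
move=> Zc; have Zn' : geval (shift_aut G B) nu Z c <> gone.
  move=> e; apply: Zc; rewrite /= /pow_meet /pow_mul /pow_join /pow_inv e.
  by rewrite -/(gabs _) gabs1; apply: X1.
have [wc mc] := ZP _ _ _ _ Zn'; split=> // m.
rewrite leq_eqVlt => /orP[/eqP ->|]; last exact: mc.
right=> cM; apply: Zc; rewrite /= /pow_meet.
rewrite (XC (fun b => iter M.+1 (@beta B) b = b)) //; first by rewrite meetC; apply: gabs_ge1.
- by move=> d dM; rewrite -iterSr iterS dM.
- move=> d dM; apply: (can_inj (@betaK B)).
  by rewrite -iterS iterSr beta_invK.
- move=> d dM; rewrite -[LHS]/(gabs (geval (shift_aut G B) nu q d)).
  have -> : geval (shift_aut G B) nu q d = gone; last exact: gabs1.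
  rewrite -[LHS]/(gmul (geval (shift_aut G B) nu (iter M.+1 (@GLam L) (GVar x)) d)
    (ginv (nu x d))).
  by rewrite geval_iter_lam iter_shift dM gmul_invr.
Qed.
End Key.

Fixpoint lam_depth X (w : gterm X) : nat :=
  match w with
  | GVar _ | GOne => 0
  | GInv w => lam_depth w
  | GMul w w' | GMeet w w' | GJoin w w' => maxn (lam_depth w) (lam_depth w')
  | GLam w | GLami w => (lam_depth w).+1
  end.

(** The value of a term at a coordinate of a kite only involves finitely many
    coordinates of the variables; [unroll a j w] is the value of w at the j-th
    coordinate of an orbit, with a variable for each coordinate of each variable. *)
Fixpoint unroll X Y (a : X -> nat -> Y) (j : nat) (w : gterm X) : gterm Y :=
  match w with
  | GVar x => GVar (a x j)
  | GOne => GOne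
  | GInv w => GInv (unroll a j w)
  | GMul w w' => GMul (unroll a j w) (unroll a j w')
  | GMeet w w' => GMeet (unroll a j w) (unroll a j w')
  | GJoin w w' => GJoin (unroll a j w) (unroll a j w')
  | GLam w => unroll a j.+1 w
  | GLami w => unroll a j.-1 w
  end.

Section Unroll.
Variables (G : lgroup) (B : bcycle) (X Y : Type) (a : X -> nat -> Y).

Lemma unrollP (lam : lgroup_aut G) (v : X -> pow_lgroup G B) (u : Y -> G) c N w j :
    (forall x k, k <= N -> v x (iter k (@beta B) c) = u (a x k)) ->
    lam_depth w <= j -> j + lam_depth w <= N ->
  geval (shift_aut G B) v w (iter j (@beta B) c) = geval lam u (unroll a j w).
Proof.
move=> vu; elim: w j => [x||w IH|w IH w' IH'|w IH w' IH'|w IH w' IH'|w IH|w IH] j //=.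
- by rewrite addn0 => _; apply: vu.
- by move=> wj jN; rewrite /pow_inv IH.
- by rewrite geq_max addn_maxr geq_max => /andP[? ?] /andP[? ?]; rewrite /pow_mul IH ?IH'.
- by rewrite geq_max addn_maxr geq_max => /andP[? ?] /andP[? ?]; rewrite /pow_meet IH ?IH'.
- by rewrite geq_max addn_maxr geq_max => /andP[? ?] /andP[? ?]; rewrite /pow_join IH ?IH'.
- move=> wj jN; rewrite /shift -iterS IH //; first by apply: leqW; apply: ltnW.
  by rewrite addSnnS.
- case: j => // j wj jN; rewrite /shift_inv iterS betaK IH //.
  by apply: leq_trans jN; rewrite addSn addnS; do 2!apply: leqW.
Qed.

(** No occurrence of the automorphism is left after unrolling. *)
Lemma unroll_pointwise (lam : lgroup_aut G) (v : Y -> pow_lgroup G B) c w j :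
  geval (shift_aut G B) v (unroll a j w) c = geval lam (v^~ c) (unroll a j w).
Proof.
elim: w j => [x||w IH|w IH w' IH'|w IH w' IH'|w IH w' IH'|w IH|w IH] j //=.
- by rewrite /pow_inv IH.
- by rewrite /pow_mul IH IH'.
- by rewrite /pow_meet IH IH'.
- by rewrite /pow_join IH IH'.
Qed.

End Unroll.

Lemma endo_iter_eq (L : lgroup) (lam : lgroup_aut L) m (f : endo_cycle lam) :
  (forall x, iter m lam x = x) -> iter m (@beta (endo_cycle lam)) f = f.
Proof. by move=> e; apply: endo_eq => x; rewrite iter_endo_beta e. Qed.

Definition id_aut (G : lgroup) : lgroup_aut G :=
  @LGroupAut G id id (fun=> erefl) (fun=> erefl) (fun _ _ => erefl) (fun _ _ => erefl)
    (fun _ _ => erefl).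

(** If an equation holds in the kites in K but fails in the kite over L, its failure
    at one coordinate becomes, after unrolling, an identity of groups that fails in L
    for certain elements a p k. In a kite in K it can only fail at a coordinate c for which
    beta^m c = c with m small, while lambda^m is not the identity: otherwise the values of
    the unrolled variables at c are the coordinates of a valuation in that kite. The
    term that separates the failure from all these m is nontrivial in L and trivial in
    the kites, which contradicts the transfer of identities. *)
Lemma irreducible_kite (K : set flw) (L : lgroup) (lam : lgroup_aut L)
    (p q : cone_flw lam) :
    K `<=` kites -> monolith p q -> generated K (cone_flw lam) ->
  generated K (kite L (endo_cycle lam)).
Proof.
move=> Kk mpq KL; apply/generatedP => -[s t] Kst.
have Lst : satisfies (cone_flw lam) (s, t) by move/generatedP: KL; apply.
apply: symbolic_satisfies => sg v.
have [-> _] := satisfies_symbolic sg (fun=> gone) Lst; split=> //.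
pose w := GMul (symbolic sg s).2 (GInv (symbolic sg t).2).
suff wE : geval (shift_aut L (endo_cycle lam)) v w = gone by apply/gmul_inv_eq1.
apply/funext => f0; apply: contrapT => wn.
have Kw G B (nu : nat -> pow_lgroup G B) : K (kite G B) ->
    geval (shift_aut G B) nu w = gone.
  by move=> /Kst/satisfies_symbolic e; have [_ {}e] := e sg nu; apply/gmul_inv_eq1.
pose N := lam_depth w.
pose f := iter N (@beta_inv (endo_cycle lam)) f0.
have fE : iter N (@beta (endo_cycle lam)) f = f0.
  rewrite /f; elim: (N) => // k IH.
  by rewrite iterSr [iter k.+1 _ f0]iterS beta_invK.
pose a x k : L := v x (iter k (@beta (endo_cycle lam)) f).
have UL : geval lam id (unroll a N w) <> gone.
  by rewrite -(@unrollP _ _ _ _ _ lam v id f (N + N)) ?fE.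
have [Z Zn ZP] := separating_term (N + N) mpq UL.
apply: Zn; apply: transfer Kk KL _ => G B KG nu.
apply/funext => c; apply: contrapT => /ZP[Uc mc].
have aE k k' : k <= N + N -> k' <= N + N ->
    iter k (@beta B) c = iter k' (@beta B) c -> a^~ k = a^~ k'.
  wlog kk : k k' / k <= k'.
    by move=> h kN k'N e; case/orP: (leq_total k k') => kk; [|apply/esym]; apply: h.
  move=> kN k'N; rewrite -(subnKC kk) !iterD => e.
  have ce : iter (k' - k) (@beta B) c = c.
    move: (k' - k) e => m e; apply/esym.
    by elim: (k) e => //= i IH /(can_inj (@betaK B)) /IH.
  have [lam1|/(_ ce) //] := mc (k' - k) (leq_trans (leq_subr _ _) k'N).
  by apply/funext => x; rewrite /a iterD (endo_iter_eq _ lam1).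
pose mu (x : nat) : pow_lgroup G B := fun d =>
  if pselect (exists k, k <= N + N /\ d = iter k (@beta B) c) is left e
  then nu (a x (sval (cid e))) c else gone.
have muE x k : k <= N + N -> mu x (iter k (@beta B) c) = nu (a x k) c.
  move=> kN; rewrite /mu; case: pselect => [e|[]]; last by exists k.
  case: cid => k' [k'N /= ce].
  by rewrite -[a x k']/((a^~ k') x) -(aE _ _ kN k'N ce).
apply: Uc; rewrite (unroll_pointwise a (id_aut G)).
by rewrite -(@unrollP _ B _ _ a (id_aut G) mu (nu^~ c) c (N + N)) // Kw.
Qed.

(** * Boolean algebras *)

Lemma BA_congruence (A : flw) (c : A) : BA A ->
  congruence (fun x y => meet x c = meet y c).
Proof.
move=> [dA _ mA].
have ld x x' y y' : meet x c = meet x' c -> meet y c = meet y' c ->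
    meet (ldiv x y) c = meet (ldiv x' y') c.
  have half u u' w w' z : meet u c = meet u' c -> meet w c = meet w' c ->
      le z (meet (ldiv u w) c) -> le z (meet (ldiv u' w') c).
    move=> uu ww /le_meet[/ldiv_residual]; rewrite mA => zw zc.
    apply/le_meet; split=> //; apply/ldiv_residual; rewrite mA.
    have e : meet u' z = meet u z by rewrite -zc !(meetC z) !meetA uu.
    apply: le_trans (meet_lel w' c); rewrite -ww; apply/le_meet.
    by rewrite e; split=> //; apply: le_trans (meet_ler _ _) zc.
  by move=> xx yy; apply: le_ext => z; split; apply: half.
have rd x y : rdiv y x = ldiv x y :> A.
  by apply: le_ext => z; rewrite ldiv_residual rdiv_residual !mA meetC.
have mm x x' y y' : meet x c = meet x' c -> meet y c = meet y' c ->
    meet (meet x y) c = meet (meet x' y') c.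
  move=> xx yy; have e u w : meet (meet u w) c = meet (meet u c) (meet w c).
    by rewrite -meetA -{1}(meetxx c) [meet u c]meetC !meetA [meet c u]meetC
      -(meetA u) -(meetA u) (meetC w) !meetA.
  by rewrite !e xx yy.
split=> [//|//|x y z -> //|||||] x x' y y' xx yy.
- exact: mm.
- by rewrite !(meetC _ c) !dA !(meetC c) xx yy.
- by rewrite !mA; apply: mm.
- exact: ld.
- by rewrite !rd; apply: ld.
Qed.

Lemma BA_quotient (A C : flw) (h : A -> C) :
  homomorphism h -> (forall c, exists x, h x = c) -> BA A -> BA C.
Proof.
move=> [hm hj hM _ [_ h0 h1]] hs [dA cA mA]; split.
- move=> x y z; have [a <-] := hs x; have [b <-] := hs y; have [c <-] := hs z.
  by rewrite -hj -!hm dA hj.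
- move=> x; have [a <-] := hs x; have [b [ab0 ab1]] := cA a.
  by exists (h b); rewrite -hm -hj ab0 ab1.
- by move=> x y; have [a <-] := hs x; have [b <-] := hs y; rewrite -hm -hM mA.
Qed.

(** A subdirectly irreducible Boolean algebra has only two elements. *)
Lemma BA_satisfies (A : flw) e : BA A -> satisfies two e -> satisfies A e.
Proof.
case: e => s t BAA st v; apply: contrapT => /monolith_quotient[C [q [qh qs mC]]].
have BAC := BA_quotient qh qs BAA; have [dC cC _] := BAC; case: mC => nC mC.
have /choice[b bE] (n : nat) : exists b, q (v n) = bot_top C b.
  have [y [xy0 xy1]] := cC (q (v n)).
  have [|x1|y1] := monolith_indecomposable (conj nC mC) (BA_congruence (q (v n)) BAC)
      (BA_congruence y BAC).
  - by move=> x; rewrite -dC xy1 meet_one.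
  - by exists true.
  - by exists false; rewrite -[LHS]meet_one -y1.
apply: nC; rewrite /= !hom_eval //.
have -> : q \o v = bot_top C \o b by apply/funext.
by rewrite -!(hom_eval _ _ (bot_top_hom C)) (st b).
Qed.

Definition unit_lattice : lattice.
Proof. by refine (@Lattice unit (fun _ _ => tt) (fun _ _ => tt) _ _ _ _ _ _) => // -[]. Defined.

Definition unit_lgroup : lgroup.
Proof.
by refine (@LGroup unit_lattice (fun _ _ => tt) (fun _ => tt) tt _ _ _ _ _) => // -[].
Defined.

Definition unit_bcycle : bcycle := @BCycle unit id id (fun=> erefl) (fun=> erefl).

Lemma cone_zero_one (L : lgroup) (lam : lgroup_aut L) : (zero : cone_flw lam) <> one.
Proof. by []. Qed.

Lemma two_satisfies (L : lgroup) (lam : lgroup_aut L) e :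
  satisfies (cone_flw lam) e -> satisfies two e.
Proof.
exact: satisfies_sub (bot_top_hom _) (bot_top_inj (@cone_zero_one L lam)).
Qed.

Lemma unit_kite_satisfies e : satisfies two e -> satisfies (kite unit_lgroup unit_bcycle) e.
Proof.
apply: (satisfies_quotient (bot_top_hom _)) => c.
have sub (x y : unit -> unit) : x = y by apply/funext => i; case: (x i); case: (y i).
by case: c => [x|x]; [exists true; apply: inl_eq|exists false; apply: inr_eq].
Qed.

Lemma BA_generated : BA = generated [set kite unit_lgroup unit_bcycle].
Proof.
apply/seteqP; split=> [A BAA|A /generatedP KA].
  apply/generatedP => e /(_ _ erefl) /two_satisfies.
  exact: BA_satisfies.
have twoA e : satisfies two e -> satisfies A e.
  by move=> te; apply: KA => C ->; apply: unit_kite_satisfies.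
split.
- move=> x y z; apply: (twoA (Meet (Var 0) (Join (Var 1) (Var 2)),
    Join (Meet (Var 0) (Var 1)) (Meet (Var 0) (Var 2))) _ (env3 x y z)) => v /=.
  by case: (v 0) (v 1) (v 2) => [] [] [].
- move=> x; exists (ldiv x zero); split.
    apply: (twoA (Meet (Var 0) (Ldiv (Var 0) Zero), Zero) _ (env3 x x x)) => v /=.
    by case: (v 0).
  apply: (twoA (Join (Var 0) (Ldiv (Var 0) Zero), One) _ (env3 x x x)) => v /=.
  by case: (v 0).
- move=> x y; apply: (twoA (Mul (Var 0) (Var 1), Meet (Var 0) (Var 1)) _ (env3 x y y)) => v /=.
  by [].
Qed.

(** * The lattice of varieties generated by kites *)

Lemma kite_PPsiMV L B : PPsiMV (kite L B).
Proof. by apply: sub_gen_smallest; split; [apply: cone_pseudo_mv|apply: cone_perfect]. Qed.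

Lemma generated_by_kites_sub V : generated_by_kites V -> V `<=` PPsiMV.
Proof.
move=> [K [_ Kk ->]]; apply: generated_sub; first exact: generated_variety.
by move=> A /Kk[L [B ->]]; apply: kite_PPsiMV.
Qed.

Lemma BA_sub_generated_by_kites V : generated_by_kites V -> BA `<=` V.
Proof.
move=> [K [[A KA] Kk ->]] C BAC; apply/generatedP => e Ke.
have := Ke _ KA; have [L [B ->]] := Kk _ KA => /two_satisfies; exact: BA_satisfies.
Qed.

Lemma generated_by_kites_BA : generated_by_kites BA.
Proof.
exists [set kite unit_lgroup unit_bcycle]; split; last exact: BA_generated.
  by exists (kite unit_lgroup unit_bcycle).
by move=> A ->; exists unit_lgroup, unit_bcycle.
Qed.

Lemma generated_kites : generated kites = PPsiMV.
Proof.
apply/seteqP; split.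
  apply: generated_sub; first exact: generated_variety.
  by move=> A [L [B ->]]; apply: kite_PPsiMV.
apply: generated_sub; first exact: generated_variety.
move=> A [Amv Ap]; have [L [lam [r [rh ri _]]]] := perfect_representation Amv Ap.
have [h [hh hi]] := cone_in_kite lam.
apply: variety_sub (generated_variety _) rh ri _.
apply: variety_sub (generated_variety _) hh hi _.
by apply: sub_gen_smallest; exists L, (endo_cycle lam).
Qed.

Lemma generated_by_kites_PPsiMV : generated_by_kites PPsiMV.
Proof.
exists kites; split=> //; last by rewrite generated_kites.
by exists (kite unit_lgroup unit_bcycle), unit_lgroup, unit_bcycle.
Qed.

Lemma generated_by_kites_join F : F !=set0 -> F `<=` generated_by_kites ->
  generated_by_kites (variety_join F).
Proof.
move=> [V0 FV0] Fk; exists (kites `&` \bigcup_(V in F) V); split.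
- have [K [[A KA] Kk V0E]] := Fk _ FV0; exists A; split; first exact: Kk.
  by exists V0 => //; rewrite V0E; apply: sub_gen_smallest.
- by move=> A [].
apply/seteqP; split; apply: generated_sub; try exact: generated_variety; last first.
  by move=> A [_ AF]; apply: sub_gen_smallest.
move=> A [V FV VA]; have [K [_ Kk VE]] := Fk _ FV.
move: VA; rewrite VE; apply: generated_sub; first exact: generated_variety.
move=> C KC; apply: sub_gen_smallest; split; first exact: Kk.
by exists V => //; rewrite VE; apply: sub_gen_smallest.
Qed.

(** A failure of an equation in A passes to a subdirectly irreducible quotient of A. This
    quotient is some K(L, lambda), hence embeds into the kite over the endomorphisms of
    L, which belongs to every variety in the family. *)
Lemma generated_by_kites_meet F : F !=set0 -> F `<=` generated_by_kites ->
  generated_by_kites (variety_meet F).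
Proof.
move=> [V0 FV0] Fk.
have Fv V : F V -> variety V by move=> /Fk[K [_ _ ->]]; apply: generated_variety.
have Wv : variety (variety_meet F) by apply: variety_bigcap.
exists (kites `&` variety_meet F); split.
- exists (kite unit_lgroup unit_bcycle); split; first by exists unit_lgroup, unit_bcycle.
  move=> V /Fk /BA_sub_generated_by_kites; apply; rewrite BA_generated.
  exact: sub_gen_smallest.
- by move=> A [].
apply/seteqP; split; last by apply: generated_sub => // A [].
move=> A WA; apply/generatedP => -[s t] Kst v; apply: contrapT.
move=> /monolith_quotient[C [q [qh qs mC]]].
have WC := variety_quotient Wv qh qs WA.
have PC : PPsiMV C by apply: generated_by_kites_sub (Fk _ FV0) _ (WC _ FV0).
have [L [lam [r [rh ri rs]]]] := perfect_representation (PPsiMV_pseudo_mv PC)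
  (monolith_perfect PC mC).
have WL := variety_quotient Wv rh rs WC.
have [h [hh hi]] := cone_in_kite lam.
have KL : (kites `&` variety_meet F) (kite L (endo_cycle lam)).
  split; first by exists L, (endo_cycle lam).
  move=> V FV; have [K [_ Kk VE]] := Fk _ FV; rewrite VE.
  apply: irreducible_kite Kk (monolith_iso rh ri rs mC) _.
  by rewrite -VE; apply: WL.
have [nC _] := mC; apply: nC; rewrite !hom_eval //.
by apply: (satisfies_sub rh ri); apply: (satisfies_sub hh hi); apply: Kst KL.
Qed.

Theorem theorem9 :
  [/\ complete_sublattice PPsiMV generated_by_kites,
      generated_by_kites PPsiMV,
      forall V, generated_by_kites V -> V `<=` PPsiMV,
      generated_by_kites BA &
      forall V, generated_by_kites V -> BA `<=` V].
Proof.
split.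
- split=> [V Vk|F F0 Fk]; last first.
    by split; [apply: generated_by_kites_meet|apply: generated_by_kites_join].
  split; last exact: generated_by_kites_sub.
  by have [K [_ _ ->]] := Vk; apply: generated_variety.
- exact: generated_by_kites_PPsiMV.
- exact: generated_by_kites_sub.
- exact: generated_by_kites_BA.
- exact: BA_sub_generated_by_kites.
Qed.
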